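(* Let $L=(S(t),\ast)$ be a Lie superalgebra of the type $S(t)$, where $\ast$ is the orthogonal or symplectic involution. Then the graded PI-exponent $\exp^{gr}(L)=\lim_{n\to\infty}\sqrt[n]{c_n^{gr}(L)}$ of $L$ exists and $\exp^{gr}(L)=2t$ if $t$ is even, and $\exp^{gr}(L)=2t-1$ if $t$ is odd.
   Context: $F$ is a field of characteristic zero. For a $\mathbb Z_2$-graded algebra $L=L_0\oplus L_1$, let $P_{k,n-k}$ be the space of multilinear nonassociative polynomials in even variables $x_1,\dots,x_k$ and odd variables $y_1,\dots,y_{n-k}$ of the absolutely free $\mathbb Z_2$-graded algebra, $Id^{gr}(L)$ the ideal of graded identities of $L$, $c_{k,n-k}(L)=\dim P_{k,n-k}/(P_{k,n-k}\cap Id^{gr}(L))$, and $c_n^{gr}(L)=\sum_{k=0}^n\binom nk c_{k,n-k}(L)$ the graded codimensions. Superalgebra $S(t)$, $t\ge 2$: take $R=UT_t(F)$ (upper triangular $t\times t$ matrices) with an involution $\ast$, either the orthogonal one $e_{ij}^\circ=e_{t+1-j,t+1-i}$, or (for $t=2m$ even) the symplectic one $X^s=DX^\circ D^{-1}$ with $D=\mathrm{diag}(E,-E)$, $E$ the $m\times m$ identity. Let $R^+=\{x: x^\ast=x\}$, $R^-=\{x:x^\ast=-x\}$. Then $S(t)=\{\begin{pmatrix} x& y\\ z& -x^\ast\end{pmatrix}: x\in R, y\in R^+, z\in R^-\}$, with even part the block-diagonal matrices and odd part the block-off-diagonal matrices, and product the supercommutator $[a,b]=ab-(-1)^{|a||b|}ba$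 of $M_2(R)$. It is a finite-dimensional solvable Lie superalgebra with non-nilpotent commutator subalgebra. *)

(* Defs.v *)
From HB Require Import structures.
From mathcomp Require Import all_boot all_order all_algebra.
From mathcomp Require Import all_classical all_reals all_analysis.
Set Implicit Arguments. Unset Strict Implicit. Unset Printing Implicit Defensive.
Import Order.TTheory GRing.Theory Num.Theory.
Local Open Scope ring_scope.

Inductive inv_kind := Orth | Symp.

Section SuperAlg.
Variable F : fieldType.
Variable t : nat.

Definition upper (x : 'M[F]_t) : Prop := forall i j : 'I_t, (j < i)%N -> x i j = 0.

Definition orth_inv (x : 'M[F]_t) : 'M[F]_t :=
  \matrix_(i, j) x (rev_ord j) (rev_ord i).

(** D = diag(E, -E) with E the (t/2) x (t/2) identity *)
Definition dsgn (i : 'I_t) : F := if (i < t./2)%N then 1 else -1.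

(** symplectic involution: X^s = D X^o D^{-1} (D^{-1} = D) *)
Definition symp_inv (x : 'M[F]_t) : 'M[F]_t :=
  \matrix_(i, j) (dsgn i * orth_inv x i j * dsgn j).

Definition star (k : inv_kind) (x : 'M[F]_t) : 'M[F]_t :=
  match k with Orth => orth_inv x | Symp => symp_inv x end.

Definition S_even (k : inv_kind) (A : 'M[F]_(t + t)) : Prop :=
  exists x : 'M[F]_t, upper x /\ A = block_mx x 0 0 (- star k x).

Definition S_odd (k : inv_kind) (A : 'M[F]_(t + t)) : Prop :=
  exists y z : 'M[F]_t, [/\ upper y, star k y = y, upper z, star k z = - z &
    A = block_mx 0 y z 0].

End SuperAlg.

(** Nonassociative monomials (binary trees) with variables indexed by nat. *)
Inductive tree := Leaf of nat | Node of tree & tree.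

Fixpoint leaves (m : tree) : seq nat :=
  match m with Leaf i => [:: i] | Node l r => leaves l ++ leaves r end.

Definition multilin (n : nat) (m : tree) : bool := perm_eq (leaves m) (iota 0 n).

(** Evaluation of a monomial in M_2(R) with the supercommutator product, for
    homogeneous substitutions: [v i] is the value of variable i and [par i]
    its parity (true = odd). Returns the value and its parity. *)
Fixpoint eval_super (F : fieldType) (N : nat) (v : nat -> 'M[F]_N)
    (par : nat -> bool) (m : tree) : 'M[F]_N * bool :=
  match m with
  | Leaf i => (v i, par i)
  | Node l r =>
      let (a, pa) := eval_super v par l in
      let (b, pb) := eval_super v par r in
      (a * b - (-1) ^+ (pa && pb) * (b * a), pa (+) pb)
  end.

Section Codim.
Variables (F : fieldType) (t : nat) (kd : inv_kind).

(** variables 0..k-1 are the even variables x_1..x_k,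
    variables k..k+l-1 are the odd variables y_1..y_l *)
Definition gpar (k : nat) (i : nat) : bool := (k <= i)%N.

Definition graded_subst (k l : nat) (v : nat -> 'M[F]_(t + t)) : Prop :=
  forall i, (i < k + l)%N ->
    if (i < k)%N then S_even kd (v i) else S_odd kd (v i).

Definition indep_mod_id (k l r : nat) (ms : 'I_r -> tree) : Prop :=
  forall a : 'I_r -> F,
    (forall v, graded_subst k l v ->
       \sum_(i < r) a i *: (eval_super v (gpar k) (ms i)).1 = 0) ->
    forall i, a i = 0.

(** c = dim P_{k,l} / (P_{k,l} \cap Id^gr(S(t))): the maximal number of
    multilinear monomials independent modulo graded identities
    (multilinear monomials form a basis of P_{k,l}) *)
Definition is_codim (k l c : nat) : Prop :=
  (exists ms : 'I_c -> tree, (forall i, multilin (k + l) (ms i)) /\ indep_mod_id k l ms)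
  /\ (forall r (ms : 'I_r -> tree), (forall i, multilin (k + l) (ms i)) ->
        indep_mod_id k l ms -> (r <= c)%N).

Definition codim (k l : nat) : nat := xget 0%N [set c | is_codim k l c].

Definition cgr (n : nat) : nat := (\sum_(k < n.+1) 'C(n, k) * codim k (n - k))%N.

End Codim.

(* Main.v *)
Require Import Defs.
From HB Require Import structures.
From mathcomp Require Import all_boot all_order all_algebra.
From mathcomp Require Import perm.
From mathcomp Require Import all_classical all_reals all_analysis.
From mathcomp Require Import zify ring lra.
Import Order.TTheory GRing.Theory Num.Theory.
Import numFieldNormedType.Exports.
Set Implicit Arguments. Unset Strict Implicit. Unset Printing Implicit Defensive.

(** Let [m = t./2] and let [D = t + 2m], which is [2t] or [2t-1]. Grade matrices
    by how far they climb along the diagonal. Modulo the strictly climbing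
    matrices, [S(t)] is spanned by [t] even and [2m] odd elements: the [m]
    commuting copies of [gl(1|1)] carried by the pairs of diagonal places
    [{p, p'}], [p' = t+1-p], together with, for [t] odd, the middle diagonal
    place, whose odd element also climbs because [z] vanishes there. A product
    with [2t] strictly climbing factors is zero, so
    [c_{k,l} <= poly(n) t^k (2m)^l], and summation gives
    [c_n <= poly(n) D^n].

    For the lower bound, left-normed products walk through the matrix units
    [e_ij] of growing intervals [[i,j]], from the centre to [[1,t]]. Each
    [e_ij] is an eigenvector of the diagonal even elements; the [t-1] weights
    met in this way, and that of an odd vector reached at the end, are linearly
    independent. On a symmetric interval [[p,p']] only the [p]-th [gl(1|1)] acts,
    and alternating its two odd generators returns to [e_pp']. Hence a
    substitution of the dual basis detects exactly which variable is assigned to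
    which of the [D] kinds. Using each kind [s] times yields
    [(Ds)!/(s!)^D >= D^(Ds)/poly(n)] independent products. *)

(** * Balanced words *)

(** A lower bound for the multinomial coefficient [(D(s+1))! / ((s+1)!)^D] without Stirling: raising
    [s] by one multiplies the numerator by [D] integers exceeding [D(s+1)] and the denominator by
    [(s+2)^D]. Telescoping leaves only the polynomial loss [(s+1)^D]. *)
Lemma fact_balanced_lower (D s : nat) :
  ((s.+1)`! ^ D * D ^ (D * s) <= (D * s.+1)`! * s.+1 ^ D)%N.
Proof.
elim: s => [|s IH].
  by rewrite muln0 expn0 muln1 !exp1n !muln1 fact_gt0.
have fact_add a b : (a`! * a ^ b <= (a + b)`!)%N.
  elim: b => [|b IHb]; first by rewrite addn0 expn0 muln1.
  rewrite addnS factS expnS mulnCA leq_mul //.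
  by rewrite -addnS leq_addr.
have H := fact_add (D * s.+1)%N D.
have -> : (D * s.+2 = D * s.+1 + D)%N by rewrite (mulnS D s.+1) addnC.
apply: leq_trans (leq_mul H (leqnn (s.+2 ^ D))).
have -> : ((s.+2)`! ^ D = s.+2 ^ D * s.+1`! ^ D)%N by rewrite factS expnMn.
have -> : (D ^ (D * s.+1) = D ^ D * D ^ (D * s))%N by rewrite mulnS expnD.
have -> : ((D * s.+1) ^ D = D ^ D * s.+1 ^ D)%N by rewrite expnMn.
have := leq_mul IH (leqnn (s.+2 ^ D * D ^ D)).
move: (s.+1`! ^ D)%N (D ^ (D * s))%N ((D * s.+1)`!)%N (s.+1 ^ D)%N => a b c d.
move: (s.+2 ^ D)%N (D ^ D)%N => e f h.
have -> : (e * a * (f * b) = a * b * (e * f))%N by lia.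
by have -> : (c * (f * d) * e = c * d * (e * f))%N by lia.
Qed.

Section Balanced.
Variables (T : finType) (s : nat).

(* The maps whose fibres all have [s] elements, presented as [fst] precomposed
   with a permutation so that the count needs no multinomial coefficients. *)
Definition balanced : {set {ffun T * 'I_s -> T}} :=
  [set phi : {ffun T * 'I_s -> T} | [exists p : {perm T * 'I_s}, [forall x, phi (p x)
    == x.1]]].

Lemma balancedP (phi : {ffun T * 'I_s -> T}) :
  phi \in balanced -> exists p : {perm T * 'I_s}, forall x, phi (p x) = x.1.
Proof.
by rewrite inE => /existsP[p /forallP h]; exists p => x; apply/eqP.
Qed.

(** Such a permutation acts separately on each of the [#|T|] fibres of [fst], hence amounts to a
    family of injections of ['I_s]. *)
Lemma card_fst_stable : 
  (#|[set p : {perm T * 'I_s} | [forall x, (p x).1 == x.1]]| <= s`! ^ #|T|)%N.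
Proof.
set A := [set p | _].
set I := [set f : {ffun 'I_s -> 'I_s} | injectiveb f].
have cI : #|I| = s`! by rewrite card_inj_ffuns card_ord ffactnn.
rewrite -cI -card_ffun_on.
pose g (p : {perm T * 'I_s}) : {ffun T -> {ffun 'I_s -> 'I_s}} :=
  [ffun c => [ffun j => (p (c, j)).2]].
have pE (p : {perm T * 'I_s}) c j : p \in A -> p (c, j) = (c, g p c j).
  rewrite inE => /forallP /(_ (c, j)) /eqP /= h.
  by rewrite !ffunE [LHS]surjective_pairing h.
rewrite -(card_in_imset (f := g) (D := A)); last first.
  move=> p p' pA p'A h; apply/permP => -[c j].
  by rewrite !pE // h.
apply/subset_leq_card/fintype.subsetP => _ /imsetP[p pA ->].
apply/ffun_onP => c; rewrite inE; apply/injectiveP => i j h.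
have : p (c, i) = p (c, j) by rewrite !pE // h.
by move/perm_inj => -[].
Qed.

(** Send a permutation [p] to [fst] after [p^-1]. Two permutations with the same image differ by one
    that preserves [fst], so each fibre of this map has at most [s!^#|T|] elements. *)
Lemma card_balanced_lower : ((#|T| * s)`! <= #|balanced| * s`! ^ #|T|)%N.
Proof.
have -> : (#|T| * s)`! = #|{perm T * 'I_s}|.
  have := card_perm [set: T * 'I_s].
  rewrite cardsT card_prod card_ord => <-; rewrite -cardsT; apply: eq_card => p.
  have pT : perm_on [set: T * 'I_s] p by apply/fintype.subsetP => x; rewrite inE.
  by rewrite !inE unfold_in; exact/esym.
pose g (p : {perm T * 'I_s}) : {ffun T * 'I_s -> T} := [ffun x => ((p^-1)%g x).1].
have gK p x : g p (p x) = x.1 by rewrite ffunE permK.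
rewrite -[X in (X <= _)%N]sum1_card (partition_big g (mem balanced)) /=; last first.
  by move=> p _; rewrite inE; apply/existsP; exists p; apply/forallP=> x; rewrite gK.
rewrite -sum_nat_const; apply: leq_sum => phi /balancedP[p0 hp0].
rewrite sum1_card; apply: leq_trans card_fst_stable.
pose f (p : {perm T * 'I_s}) := (p * p0^-1)%g.
rewrite -(fintype.card_image (f := f)); last by move=> p p' /mulIg.
apply/subset_leq_card/fintype.subsetP => _ /fintype.imageP[p pA ->].
rewrite inE; apply/forallP=> x; rewrite -hp0 permM permKV.
by have /eqP <- : g p == phi := pA; rewrite gK.
Qed.

End Balanced.

(** * Codimensions and evaluation of monomials *)

Local Open Scope ring_scope.

Section CodimBounds.
Variables (F : fieldType) (t : nat) (kd : inv_kind) (k l : nat).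

Definition independent_family (r : nat) : Prop :=
  exists ms : 'I_r -> tree,
    (forall i, multilin (k + l) (ms i)) /\ @indep_mod_id F t kd k l r ms.

(** [xget] falls back on [0] when no maximum exists; a uniform bound [B] on independent families
    supplies one, so that [codim] has its intended meaning. *)
Lemma codimP B : (forall r, independent_family r -> (r <= B)%N) ->
  is_codim F t kd k l (codim F t kd k l).
Proof.
move=> hB; rewrite /codim; apply: (xgetPex 0%N (P := [set c | is_codim F t kd k l c])).
have ex0 : independent_family 0.
  exists (fun=> Leaf 0); split=> [[]//|a _ []//].
have ub r : `[< independent_family r >] -> (r <= B)%N by move/asboolP/hB.
have ex : exists r, `[< independent_family r >] by exists 0%N; apply/asboolP.
case: (ex_maxnP ex ub) => c /asboolP hc hmax; exists c; split=> // r ms h1 h2.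
by apply/hmax/asboolP; exists ms.
Qed.

Lemma codim_le B : (forall r, independent_family r -> (r <= B)%N) ->
  (codim F t kd k l <= B)%N.
Proof. by move=> hB; have [h _] := codimP hB; exact: hB. Qed.

Lemma codim_ge B r : (forall r', independent_family r' -> (r' <= B)%N) ->
  independent_family r -> (r <= codim F t kd k l)%N.
Proof. by move=> hB [ms [h1 h2]]; have [_ h] := codimP hB; exact: (h _ ms). Qed.

End CodimBounds.

Lemma codim_bounds_total (F : fieldType) t kd n D0 D1 C :
  (forall k l, k + l = n -> codim F t kd k l <= C * (D0 ^ k * D1 ^ l))%N ->
  (cgr F t kd n <= C * (D0 + D1) ^ n)%N.
Proof.
move=> h; rewrite (addnC D0) expnDn /cgr big_distrr /=; apply: leq_sum => k _.
rewrite mulnCA leq_mul2l; apply/orP; right; rewrite (mulnC (D1 ^ _)%N).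
by apply: h; rewrite subnKC // -ltnS.
Qed.

(** * Multilinearity of monomials and the climbing filtration *)

Section Evaluation.
Variables (F : fieldType) (N : nat).
Implicit Types (v : nat -> 'M[F]_N) (m : tree).

Definition superbr (P Q : 'M[F]_N * bool) : 'M[F]_N * bool :=
  (P.1 * Q.1 - (-1) ^+ (P.2 && Q.2) * (Q.1 * P.1), P.2 (+) Q.2).

Lemma eval_superN v par m1 m2 :
  eval_super v par (Node m1 m2) =
  superbr (eval_super v par m1) (eval_super v par m2).
Proof. by rewrite /=; case: eval_super => a pa; case: eval_super. Qed.

Fixpoint tree_par (par : nat -> bool) m : bool :=
  match m with
  | Leaf i => par i
  | Node l r => tree_par par l (+) tree_par par r
  end.

Lemma eval_super_par v par m : (eval_super v par m).2 = tree_par par m.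
Proof. by elim: m => //= l <- r <-; case: eval_super => a pa; case: eval_super. Qed.

Lemma eq_eval_super v v' par m : {in leaves m, v =1 v'} ->
  eval_super v par m = eval_super v' par m.
Proof.
elim: m => [i|m1 IH1 m2 IH2] h; first by rewrite /= h //= inE.
rewrite !eval_superN IH1 ?IH2 // => i im; apply: h;
  by rewrite /= mem_cat im ?orbT.
Qed.

Definition upd (T : Type) (v : nat -> T) (j : nat) (x : T) : nat -> T :=
  fun i => if i == j then x else v i.

Definition linear_map (Z : 'M[F]_N -> 'M[F]_N) : Prop :=
  forall a x y, Z (a *: x + y) = a *: Z x + Z y.

Lemma linear_map0 Z : linear_map Z -> Z 0 = 0.
Proof. by move=> h; have := h (-1) 0 0; rewrite scaler0 add0r scaleN1r addNr. Qed.

Lemma linear_map_sum0 Z (I : finType) (c : I -> F) f : linear_map Z ->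
  (forall i, Z (f i) = 0) -> Z (\sum_i c i *: f i) = 0.
Proof.
move=> h hf; elim/big_rec: _ => [|i x _ hx]; first exact: linear_map0.
by rewrite h hf hx scaler0 addr0.
Qed.

Lemma linear_map_add0 Z x y : linear_map Z -> Z x = 0 -> Z y = 0 -> Z (x + y) = 0.
Proof. by move=> h hx hy; rewrite -[x]scale1r h hx hy scaler0 addr0. Qed.

Lemma eval_super_linear v par j m : count_mem j (leaves m) = 1%N ->
  linear_map (fun x => (eval_super (upd v j x) par m).1).
Proof.
(* A factor without the variable [j] ignores the substituted value; since [j] occurs once, exactly
   one factor of each bracket containing it varies. *)
have const m' x y : j \notin leaves m' ->
    eval_super (upd v j x) par m' = eval_super (upd v j y) par m'.
  move=> jm; apply: eq_eval_super => i im; rewrite /upd.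
  by case: eqP => // ij; rewrite -ij im in jm.
elim: m => [i|m1 IH1 m2 IH2].
  by rewrite /= addn0 /upd => /eqP; rewrite eqb1 => /eqP -> a x y; rewrite eqxx.
move=> h a x y; rewrite !eval_superN /superbr /= !eval_super_par.
move: h; rewrite /= count_cat.
case E1 : (count_mem j (leaves m1)) => [|c1] h.
  rewrite (IH2 h) !(const m1 _ y) ?(const m1 x y) -?has_pred1 ?has_count ?E1 //.
  rewrite -!mulmxE mulmxDr mulmxDl mulmxDr -scalemxAl -!scalemxAr scalerBr.
  by rewrite opprD addrACA.
move: h => /eqP; rewrite addSn eqSS addn_eq0 => /andP[/eqP c0 /eqP E2].
rewrite {c1}c0 in E1.
rewrite (IH1 E1) !(const m2 _ y) ?(const m2 x y) -?has_pred1 ?has_count ?E2 //.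
rewrite -!mulmxE mulmxDl !mulmxDr -scalemxAl -!scalemxAr scalerBr.
by rewrite opprD addrACA.
Qed.

Variable lev : 'I_N -> nat.

(** A filtration of the matrix algebra: weights add under products, and a weight exceeding every
    difference of levels forces the zero matrix. *)
Definition raises (w : nat) (A : 'M[F]_N) : Prop :=
  forall a b, (lev b < lev a + w)%N -> A a b = 0.

Lemma raisesM w w' A B : raises w A -> raises w' B -> raises (w + w') (A * B).
Proof.
move=> hA hB a b hab; rewrite -mulmxE mxE big1 // => c _.
case: (ltnP (lev c) (lev a + w)) => hac; first by rewrite hA // mul0r.
by rewrite hB ?mulr0 //; lia.
Qed.

Lemma raises_sign w (b : bool) A : raises w A -> raises w ((-1) ^+ b * A).
Proof.
move=> h i j hij; case: b; last by rewrite expr0 mul1r h.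
by rewrite expr1 mulN1r mxE h // oppr0.
Qed.

Lemma raisesB w A B : raises w A -> raises w B -> raises w (A - B).
Proof. by move=> hA hB i j h; rewrite !mxE hA // hB // subr0. Qed.

Lemma raises_eval v par (dg : nat -> nat) m :
  (forall i, i \in leaves m -> raises (dg i) (v i)) ->
  raises (\sum_(i <- leaves m) dg i) (eval_super v par m).1.
Proof.
elim: m => [i|m1 IH1 m2 IH2] h.
  by rewrite /= big_seq1; apply: h; rewrite /= inE.
have h1 : raises (\sum_(i <- leaves m1) dg i) (eval_super v par m1).1.
  by apply: IH1 => i im; apply: h; rewrite /= mem_cat im.
have h2 : raises (\sum_(i <- leaves m2) dg i) (eval_super v par m2).1.
  by apply: IH2 => i im; apply: h; rewrite /= mem_cat im orbT.
rewrite eval_superN /superbr /= big_cat /=.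
apply: raisesB; first exact: raisesM.
by apply: raises_sign; rewrite addnC; apply: raisesM.
Qed.

End Evaluation.

(** * The upper bound *)

Section Star.
Variables (F : fieldType) (t : nat) (kd : inv_kind).

Lemma dsgn_sqr (i : 'I_t) : dsgn F i * dsgn F i = 1.
Proof. by rewrite /dsgn; case: ifP => _; rewrite ?mulr1 // mulrNN mulr1. Qed.

Lemma star_diag (x : 'M[F]_t) i : star kd x i i = x (rev_ord i) (rev_ord i).
Proof. by case: kd; rewrite /= !mxE // mulrC mulrA dsgn_sqr mul1r. Qed.

Lemma star_upper (x : 'M[F]_t) : upper x -> upper (star kd x).
Proof.
move=> hx i j ij; have h : x (rev_ord j) (rev_ord i) = 0.
  by apply: hx => /=; have := ltn_ord i; lia.
by case: kd; rewrite /= !mxE h // mulr0 mul0r.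
Qed.

Lemma rev_mid (i : 'I_t) : odd t -> i = t./2 :> nat -> rev_ord i = i.
Proof. by move=> ot it; apply/val_inj; rewrite /= it; lia. Qed.

Lemma half_le_self n : (n./2 <= n)%N.
Proof. by lia. Qed.

Definition lower_place (c : 'I_(t./2)) : 'I_t := widen_ord (half_le_self t) c.

End Star.

(** * Generators of the superalgebra modulo climbing matrices *)

Section Upper.
Variables (F : fieldType) (t : nat) (kd : inv_kind).

Definition is_middle (i : 'I_t) : bool := odd t && (i == t./2 :> nat).

(* The bottom copy of the middle place sits one step above its top copy, so that
   the middle odd element climbs. *)
Definition level (a : 'I_(t + t)) : nat :=
  match fintype.split a with
  | inl i => i.*2
  | inr i => i.*2 + is_middle i
  end.

Lemma level_l i : level (lshift t i) = i.*2.
Proof. by rewrite /level -[lshift t i]/(unsplit (inl i)) unsplitK. Qed.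

Lemma level_r i : level (rshift t i) = (i.*2 + is_middle i)%N.
Proof. by rewrite /level -[rshift t i]/(unsplit (inr i)) unsplitK. Qed.

Lemma level_bound a : (level a < t.*2)%N.
Proof.
case: (split_ordP a) => i ->; rewrite ?level_l ?level_r; have := ltn_ord i.
  by lia.
by case: (is_middle i); lia.
Qed.

Lemma raises_block w (A B C D : 'M[F]_t) :
  (forall i j : 'I_t, (j.*2 < i.*2 + w)%N -> A i j = 0) ->
  (forall i j : 'I_t, (j.*2 + is_middle j < i.*2 + w)%N -> B i j = 0) ->
  (forall i j : 'I_t, (j.*2 < i.*2 + is_middle i + w)%N -> C i j = 0) ->
  (forall i j : 'I_t, (j.*2 + is_middle j < i.*2 + is_middle i + w)%N -> D i j = 0) ->
  raises level w (block_mx A B C D).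
Proof.
move=> hA hB hC hD a b.
case: (split_ordP a) => i ->; case: (split_ordP b) => j ->;
  rewrite ?level_l ?level_r ?block_mxEul ?block_mxEur ?block_mxEdl ?block_mxEdr => h.
- exact: hA.
- exact: hB.
- exact: hC.
- exact: hD.
Qed.

(** On diagonal entries both involutions only exchange [i] and [rev_ord i], so the diagonal
    generators do not depend on the kind. *)
Definition even_gen (c : 'I_t) : 'M[F]_(t + t) :=
  block_mx (delta_mx c c) 0 0 (- delta_mx (rev_ord c) (rev_ord c)).

Definition odd_gen (c : 'I_(t./2) * bool) : 'M[F]_(t + t) :=
  let i := lower_place c.1 in
  if c.2 then block_mx 0 (delta_mx i i + delta_mx (rev_ord i) (rev_ord i)) 0 0
  else block_mx 0 0 (delta_mx i i - delta_mx (rev_ord i) (rev_ord i)) 0.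

(** The climbing part is covered by single matrix units, which need not lie in [S(t)]: for an upper
    bound a larger spanning set is harmless. *)
Definition generator : finType :=
  (('I_t + 'I_(t./2) * bool) + 'I_(t + t) * 'I_(t + t))%type.

Definition gen (g : generator) : 'M[F]_(t + t) :=
  match g with
  | inl (inl c) => even_gen c
  | inl (inr c) => odd_gen c
  | inr (a, b) => if (level a < level b)%N then delta_mx a b else 0
  end.

Definition gdeg (g : generator) : nat := if g is inr _ then 1 else 0.

Lemma rev_ord_eq (i j : 'I_t) : (rev_ord i == j) = (i == rev_ord j).
Proof. by rewrite -(inj_eq rev_ord_inj) rev_ordK. Qed.

Lemma raises_gen g : raises level (gdeg g) (gen g).
Proof.
have deltaE (c i j : 'I_t) : (j < i)%N -> ((i == c) && (j == c))%:R = 0 :> F.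
  by move=> ij; case: eqP => //= <-; rewrite -val_eqE /= ltn_eqF.
case: g => [[c|[c b]]|[a b]] /=.
- apply: raises_block => i j h; rewrite ?mxE //; first by rewrite deltaE //; lia.
  rewrite deltaE ?oppr0 //; have [E|] := eqVneq i j; first by move: h; rewrite E; lia.
  by rewrite -val_eqE /=; move: h; case: (is_middle i); case: (is_middle j); lia.
- have nmid (i : 'I_t) : is_middle i -> (i == lower_place c) = false /\ (i == rev_ord
    (lower_place c)) = false.
    move=> /andP[ot /eqP it]; split; apply/negP => /eqP /(congr1 val) /=; rewrite it;
      have := ltn_ord c; lia.
  rewrite /odd_gen /=; case: b; apply: raises_block => i j h; rewrite ?mxE //.
  + have ij : (j < i)%N by move: h; case: (is_middle j); lia.
    by rewrite !deltaE // addr0.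
  + have [mi|] := boolP (is_middle i).
      by have [-> ->] := nmid i mi; rewrite subr0.
    move=> /negbTE mi; have ij : (j < i)%N by move: h; rewrite mi; lia.
    by rewrite !deltaE // subr0.
- move=> i j; case: ifP => ab; last by rewrite mxE.
  by rewrite mxE; case: eqP => // ->; case: eqP => // ->; lia.
Qed.

Lemma sum_lower_place (f : 'I_t -> F) (i j : 'I_t) :
  \sum_(c < t./2) f (lower_place c) * ((i == lower_place c) && (j == lower_place c))%:R
    =
  ((i == j) && (i < t./2)%N)%:R * f i.
Proof.
case: (ltnP i t./2) => hi; last first.
  rewrite andbF mul0r big1 // => c _; case: eqP => [ic|]; last by rewrite mulr0.
  by move: hi; rewrite ic leqNgt /= ltn_ord.
have E : i = lower_place (Ordinal hi) by apply: val_inj.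
rewrite (bigD1 (Ordinal hi)) //= -E eqxx andbT /= (eq_sym j) big1 ?addr0 1?mulrC //.
move=> c cn; case: eqP => [ic|]; last by rewrite mulr0.
by case/eqP: cn; apply: val_inj => /=; rewrite ic.
Qed.

Lemma sum_lower_place_pair (f : 'I_t -> F) (s : F) (i j : 'I_t) :
  (\sum_(c < t./2) f (lower_place c) *: (delta_mx (lower_place c) (lower_place c) +
      s *: delta_mx (rev_ord (lower_place c)) (rev_ord (lower_place c)) : 'M[F]_t)) i j
        =
  (i == j)%:R * ((i < t./2)%:R * f i + s * ((rev_ord i < t./2)%:R * f (rev_ord i))).
Proof.
rewrite summxE mulrDr.
transitivity (\sum_(c < t./2) f (lower_place c) * ((i == lower_place c) && (j ==
  lower_place c))%:R
  + s * \sum_(c < t./2) f (lower_place c) * ((rev_ord i == lower_place c) && (rev_ord j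
      == lower_place c))%:R).
  rewrite big_distrr -big_split /=; apply: eq_bigr => c _.
  by rewrite !mxE mulrDr !rev_ord_eq; ring.
rewrite !sum_lower_place (inj_eq rev_ord_inj); case: (i == j); case: ltnP; case: ltnP;
  rewrite /= ?mul1r ?mul0r ?mulr0 ?addr0 //; ring.
Qed.

Definition legal (k i : nat) (g : generator) : bool :=
  match g with
  | inl (inl _) => (i < k)%N
  | inl (inr _) => (k <= i)%N
  | inr _ => true
  end.

(** Spanning is expressed dually, through linear maps that vanish on the generators; this form
    allows one variable of a monomial to be replaced at a time. *)
Lemma raises1_kernel (Z : 'M[F]_(t + t) -> 'M[F]_(t + t)) A :
  linear_map Z -> (forall p, Z (gen (inr p)) = 0) -> raises level 1 A -> Z A = 0.
Proof.
move=> lZ hZ hA.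
have -> : A = \sum_p A p.1 p.2 *: gen (inr p).
  rewrite {1}[A]matrix_sum_delta pair_bigA /=; apply: eq_bigr => -[a b] _ /=.
  by case: ltnP => // ab; rewrite hA ?scale0r ?scaler0 // addn1 ltnS.
exact: linear_map_sum0.
Qed.

Hypothesis h2 : 2%:R != 0 :> F.

(** Subtracting the diagonal generators, with coefficients read from [A], leaves a climbing matrix:
    off-diagonal upper entries raise the level, and in the odd case the involution determines one
    half of each diagonal from the other. *)
Lemma graded_kernel k i A (Z : 'M[F]_(t + t) -> 'M[F]_(t + t)) :
  linear_map Z -> (if (i < k)%N then S_even kd A else S_odd kd A) ->
  (forall g, legal k i g -> Z (gen g) = 0) -> Z A = 0.
Proof.
move=> lZ hA hZ; case: ltnP hA => ik.
- case=> x [ux ->]; set B := block_mx _ _ _ _.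
  pose S : 'M[F]_(t + t) := \sum_(c < t) x c c *: gen (inl (inl c)).
  rewrite -(subrK S B) addrC; apply: linear_map_add0 => //.
    by apply: linear_map_sum0 => // c; apply: hZ; rewrite /= ik.
  apply: raises1_kernel => //; first by move=> p; apply: hZ.
  have sumE (i0 j0 : 'I_t) : (\sum_(c < t) x c c *: (delta_mx c c : 'M[F]_t)) i0 j0 =
    (i0 == j0)%:R * x i0 i0.
    rewrite summxE (bigD1 i0) //= big1 ?addr0 ?mxE ?eqxx /= 1?mulrC 1?(eq_sym j0) //.
    by move=> c /negbTE ci; rewrite !mxE eq_sym ci mulr0.
  have sumrE (i0 j0 : 'I_t) : (\sum_(c < t) x c c *: (delta_mx (rev_ord c) (rev_ord c)
    : 'M[F]_t)) i0 j0
      = (i0 == j0)%:R * x (rev_ord i0) (rev_ord i0).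
    rewrite -(inj_eq rev_ord_inj) -sumE !summxE; apply: eq_bigr => c _.
    by rewrite !mxE !rev_ord_eq.
  have -> : S = block_mx (\sum_(c < t) x c c *: delta_mx c c) 0 0
                  (- \sum_(c < t) x c c *: delta_mx (rev_ord c) (rev_ord c)).
    rewrite /S; elim/big_rec3: _ => [|c X Y W _ ->]; first by rewrite oppr0 block_mx0.
    by rewrite /gen /even_gen scale_block_mx !scaler0 add_block_mx !addr0 opprD scalerN.
  rewrite /B opp_block_mx add_block_mx !oppr0 !addr0 opprK.
  apply: raises_block => i0 j0 h; rewrite [LHS]mxE.
  + rewrite [X in _ + X]mxE sumE; case: eqP => [->|/eqP ij]; first by rewrite mul1r
      subrr.
    by rewrite mul0r subr0; apply: ux; move: ij; rewrite -val_eqE /=; lia.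
  + by [].
  + by [].
  + rewrite mxE sumrE; case: eqP => [->|/eqP ij]; first by rewrite mul1r star_diag
      addNr.
    rewrite mul0r addr0 (star_upper kd ux) ?oppr0 //.
    by move: ij h; rewrite -val_eqE /=; case: (is_middle i0); case: (is_middle j0); lia.
- case=> y [z [uy sy uz sz ->]]; set B := block_mx _ _ _ _.
  pose Sy : 'M[F]_(t + t) := \sum_(c < t./2) y (lower_place c) (lower_place c) *: gen
    (inl (inr (c, true))).
  pose Sz : 'M[F]_(t + t) := \sum_(c < t./2) z (lower_place c) (lower_place c) *: gen
    (inl (inr (c, false))).
  rewrite -(subrK (Sy + Sz) B) addrC; apply: linear_map_add0 => //.
    by apply: linear_map_add0 => //; apply: linear_map_sum0 => // c; apply: hZ; rewrite
      /= ik.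
  apply: raises1_kernel => //; first by move=> p; apply: hZ.
  have -> : Sy = block_mx 0 (\sum_(c < t./2) y (lower_place c) (lower_place c) *:
    (delta_mx (lower_place c) (lower_place c) +
      1 *: delta_mx (rev_ord (lower_place c)) (rev_ord (lower_place c)))) 0 0.
    rewrite /Sy; elim/big_rec2: _ => [|c X Y _ ->]; first by rewrite block_mx0.
    by rewrite /gen /odd_gen /= scale1r scale_block_mx !scaler0 add_block_mx !addr0.
  have -> : Sz = block_mx 0 0 (\sum_(c < t./2) z (lower_place c) (lower_place c) *:
    (delta_mx (lower_place c) (lower_place c) +
      (-1) *: delta_mx (rev_ord (lower_place c)) (rev_ord (lower_place c)))) 0.
    rewrite /Sz; elim/big_rec2: _ => [|c X Y _ ->]; first by rewrite block_mx0.
    by rewrite /gen /odd_gen /= scaleN1r scale_block_mx !scaler0 add_block_mx !addr0.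
  rewrite /B add_block_mx opp_block_mx add_block_mx !(addr0, add0r, oppr0).
  apply: raises_block => i0 j0 h; rewrite [LHS]mxE //.
  + rewrite [X in _ + X]mxE (sum_lower_place_pair (fun i => y i i)); case: eqP =>
      [E|/eqP ij]; last first.
      by rewrite mul0r subr0; apply: uy; move: ij h; rewrite -val_eqE /=; case:
        (is_middle j0); lia.
    subst j0; rewrite !mul1r.
    have yE : y i0 i0 = y (rev_ord i0) (rev_ord i0) by rewrite -(star_diag kd) sy.
    (* The middle entry of [y] does not arise here: it leads to the raised bottom copy of its place,
       hence already climbs. *)
    have nm : is_middle i0 = false by move: h; case: (is_middle i0); lia.
    have [hi|hi] := ltnP i0 t./2.
      have -> : (rev_ord i0 < t./2)%N = false by rewrite /=; lia.
      by rewrite mul1r mul0r addr0 subrr.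
    have -> : (rev_ord i0 < t./2)%N = true.
      by move: nm hi; rewrite /is_middle /=; have := ltn_ord i0; case: (boolP (odd t))
        => ot; lia.
    by rewrite mul0r add0r mul1r yE subrr.
  + rewrite [X in _ + X]mxE (sum_lower_place_pair (fun i => z i i)); case: eqP =>
      [E|/eqP ij]; last first.
      by rewrite mul0r subr0; apply: uz; move: ij h; rewrite -val_eqE /=; case:
        (is_middle i0); lia.
    subst j0; rewrite mul1r.
    have zE : z i0 i0 = - z (rev_ord i0) (rev_ord i0) by rewrite -(star_diag kd) sz mxE
      opprK.
    have [hi|hi] := ltnP i0 t./2.
      have -> : (rev_ord i0 < t./2)%N = false by rewrite /=; lia.
      by rewrite mul1r mul0r mulr0 addr0 subrr.
    have [mi|nm] := boolP (is_middle i0).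
      have rE : rev_ord i0 = i0 by case/andP: mi => ot /eqP; exact: rev_mid.
      rewrite rE ltnNge hi /= !mul0r mulr0 addr0 subr0.
      (* At the middle place skewness reads [z = -z], so the entry vanishes because [2] is
         nonzero. *)
      have : 2%:R * z i0 i0 = 0 by rewrite mulr_natl mulr2n {1}zE rE addNr.
      by move/eqP; rewrite mulf_eq0 (negbTE h2) => /eqP.
    have -> : (rev_ord i0 < t./2)%N = true.
      by move: nm hi; rewrite /is_middle /=; have := ltn_ord i0; case: (boolP (odd t))
        => ot; lia.
    by rewrite mul0r add0r mul1r mulN1r opprK zE addNr.
Qed.

End Upper.

(** * Counting the substitutions of generators *)

Section CodimUpper.
Variables (F : fieldType) (t : nat) (kd : inv_kind) (k l : nat).
Hypothesis h2 : 2%:R != 0 :> F.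
Hypothesis t_ge2 : (2 <= t)%N.
Hypothesis n_gt0 : (0 < k + l)%N.
Local Notation n := (k + l)%N.
Local Notation W := (t.*2).

(* At most [W] of the variables need a climbing value: the first two components
   choose non-climbing values everywhere, the third corrects up to [W] of them. *)
Definition choices : finType :=
  ({ffun 'I_k -> 'I_t} * {ffun 'I_l -> 'I_(t./2) * bool} *
   {ffun 'I_W -> option ('I_n * generator t)})%type.

Definition base_choice (p : choices) (i : 'I_n) : generator t :=
  match fintype.split i with
  | inl j => inl (inl (p.1.1 j))
  | inr j => inl (inr (p.1.2 j))
  end.

Definition choice_of (p : choices) (i : 'I_n) : generator t :=
  if [pick j | omap fst (p.2 j) == Some i] is Some j
  then oapp snd (base_choice p i) (p.2 j) else base_choice p i.

(** The non-climbing generators are read off position by position; the climbing ones, fewer than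
    [W], are listed in the correction table. *)
Lemma choice_cover (g : 'I_n -> generator t) :
  (forall i : 'I_n, legal k i (g i)) -> (\sum_i gdeg (g i) < W)%N ->
  exists p, forall i, choice_of p i = g i.
Proof.
move=> lg dg.
(* Default entries for the positions that the correction table overwrites; [d0] exists because
   [t >= 2]. *)
have c0 : 'I_t by exists 0%N; lia.
have d0 : 'I_(t./2) by exists 0%N; lia.
pose s := [seq i <- enum 'I_n | gdeg (g i) == 1%N].
have sz : (size s <= W)%N.
  apply: leq_trans (ltnW dg); rewrite size_filter -sum1_count big_mkcond /= big_enum.
  by apply: leq_sum => i _; case: eqP => // ->.
pose p : choices :=
  ([ffun j : 'I_k => if g (lshift l j) is inl (inl c) then c else c0],
   [ffun j : 'I_l => if g (rshift k j) is inl (inr c) then c else (d0, true)],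
   [ffun j : 'I_W => nth None [seq Some (i, g i) | i <- s] j]).
have pE (j : 'I_W) i' x : p.2 j = Some (i', x) -> i' \in s /\ x = g i'.
  rewrite ffunE; case: (ltnP j (size s)) => js; last by rewrite nth_default ?size_map.
  have i0 : 'I_n by exists 0%N.
  by rewrite (nth_map i0) // => -[<- <-]; rewrite mem_nth.
exists p => i; rewrite /choice_of; case: pickP => [j|hj].
  by case E : (p.2 j) => [[i' x]|] //= /eqP[<-]; have [_ ->] := pE _ _ _ E.
have : i \notin s.
  apply/negP => si; have ij : (index i s < W)%N by apply: leq_trans sz; rewrite
    index_mem.
  have := hj (Ordinal ij); rewrite ffunE /= (nth_map i) ?index_mem //= nth_index //.
  by rewrite eqxx.
rewrite mem_filter mem_enum andbT; have := lg i.
rewrite /base_choice; case: (split_ordP i) => j ->; rewrite /= ffunE.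
  by case: (g _) => [[c|c]|c] //=; rewrite leqNgt ltn_ord.
by case: (g _) => [[c|c]|c] //=; rewrite ltnNge leq_addr.
Qed.

Lemma multilin_count (m : tree) (j : nat) : multilin n m -> (j < n)%N ->
  count_mem j (leaves m) = 1%N.
Proof.
move=> /seq.permP -> jn; rewrite count_uniq_mem ?iota_uniq //.
by rewrite mem_iota /= add0n jn.
Qed.

Section Combination.
Variables (r : nat) (ms : 'I_r -> tree) (a : 'I_r -> F).
Hypothesis mlin : forall i, multilin n (ms i).

Definition comb (v : nat -> 'M[F]_(t + t)) : 'M[F]_(t + t) :=
  \sum_i a i *: (eval_super v (gpar k) (ms i)).1.

Lemma comb_linear v j : (j < n)%N -> linear_map (fun x => comb (upd v j x)).
Proof.
move=> jn b x y; rewrite /comb scaler_sumr -big_split /=; apply: eq_bigr => i _.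
rewrite (eval_super_linear _ _ (multilin_count (mlin i) jn)).
by rewrite scalerDr !scalerA (mulrC b).
Qed.

Lemma eq_comb v v' : (forall i, (i < n)%N -> v i = v' i) -> comb v = comb v'.
Proof.
move=> h; apply: eq_bigr => i _; congr (_ *: _.1); apply: eq_eval_super => j.
by rewrite (perm_mem (mlin i)) mem_iota /= add0n; exact: h.
Qed.

Definition extend (g : 'I_n -> generator t) (i : nat) : 'M[F]_(t + t) :=
  oapp (fun j => gen F (g j)) 0 (insub i).

(** With fewer than [W] climbing values the assignment is covered by a choice; with [W] or more,
    every monomial climbs past all levels, which are below [W], and vanishes. *)
Lemma comb_generators (g : 'I_n -> generator t) :
  (forall p, comb (extend (choice_of p)) = 0) ->
  (forall i : 'I_n, legal k i (g i)) -> comb (extend g) = 0.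
Proof.
move=> h lg; case: (ltnP (\sum_i gdeg (g i)) W) => dg.
  have [p hp] := choice_cover lg dg; rewrite -[RHS](h p); apply: eq_comb => i ik.
  by rewrite /extend; case: insub => //= j; rewrite hp.
rewrite /comb big1 // => i _; suff -> : (eval_super (extend g) (gpar k) (ms i)).1 = 0
  by rewrite scaler0.
pose dgn (j : nat) := oapp (fun j => gdeg (g j)) 0%N (insub j).
have : raises (@level t) (\sum_(j <- leaves (ms i)) dgn j) (eval_super (extend g) (gpar
  k) (ms i)).1.
  apply: raises_eval => j _; rewrite /extend /dgn; case: insub => /= [j'|]; first
    exact: raises_gen.
  by move=> b c _; rewrite mxE.
have -> : (\sum_(j <- leaves (ms i)) dgn j = \sum_j gdeg (g j))%N.
  have E : iota 0 n = index_iota 0 n by rewrite /index_iota subn0.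
  rewrite (perm_big _ (mlin i)) /= E big_mkord; apply: eq_bigr => j _.
  by rewrite /dgn insubT //= => lj; congr (gdeg (g _)); apply: val_inj.
move=> hz; apply/matrixP => b c; rewrite mxE hz //.
by have := level_bound c; move: dg; lia.
Qed.

Lemma comb_graded v : (forall p, comb (extend (choice_of p)) = 0) ->
  graded_subst kd k l v -> comb v = 0.
Proof.
move=> h gv.
(* The first [j] variables take arbitrary graded values and the others are generators, so the
   induction step is [graded_kernel] applied to a single variable. *)
suff H j (g : 'I_n -> generator t) u : (j <= n)%N -> (forall i : 'I_n, legal k i (g i))
  ->
    (forall i, (i < j)%N -> u i = v i) -> (forall i, (j <= i)%N -> u i = extend g i) ->
    comb u = 0.
  have c0 : 'I_t by exists 0%N; lia.
  have d0 : 'I_(t./2) by exists 0%N; lia.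
  have e0 : 'I_(t + t) by exists 0%N; lia.
  (* Values at indices from [n] on do not affect [comb]; they are replaced to fit the induction. *)
  rewrite (@eq_comb v (fun i => if (i < n)%N then v i else extend (fun=> inr (e0, e0))
    i)); last first.
    by move=> i ->.
  apply: (H n (fun=> inr (e0, e0))) => // i; first by move=> ->.
  by rewrite ltnNge => ->.
elim: j g u => [|j IH] g u jn lg hu hg.
  by rewrite (@eq_comb u (extend g)) ?comb_generators // => i _; apply: hg.
have uE : forall i, (i < n)%N -> u i = upd u j (v j) i.
  by move=> i _; rewrite /upd; case: eqP => // ->; rewrite hu.
rewrite (eq_comb uE) {uE}.
apply: (graded_kernel (kd := kd) (k := k) (i := j) h2 (comb_linear _ jn)); first exact:
  gv.
move=> g' lg'.
pose g1 (i : 'I_n) := if i == j :> nat then g' else g i.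
apply: (IH g1); first exact: ltnW.
- by move=> i; rewrite /g1; case: eqP => // ->.
- move=> i ij; rewrite /upd; case: eqP => [E|_]; first by rewrite E ltnn in ij.
  by apply: hu; apply: ltnW.
- move=> i ij; rewrite /upd /extend; case: eqP => [E|/eqP E].
    by rewrite insubT ?E // => lj; rewrite /= /g1 eqxx.
  rewrite hg; last by rewrite ltn_neqAle eq_sym E.
  by rewrite /extend; case: insubP => //= i' _ i'E; rewrite /g1 i'E (negbTE E).
Qed.

End Combination.

(** Each monomial gives a row: its [W ^ 2] entries under every choice. More rows than columns would
    give a linear relation, which by [comb_graded] is a graded identity. *)
Lemma independent_upper r : independent_family F t kd k l r ->
  (r <= #|{: choices}| * W ^ 2)%N.
Proof.
case=> ms [mlin ind]; rewrite leqNgt; apply/negP => hr.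
pose J := (choices * ('I_(t + t) * 'I_(t + t)))%type.
have cJ : #|{: J}| = (#|{: choices}| * W ^ 2)%N.
  by rewrite !card_prod !card_ord addnn.
pose B : 'M[F]_(r, #|{: J}|) := \matrix_(i, x)
  (eval_super (extend (choice_of (enum_val x).1)) (gpar k) (ms i)).1
    (enum_val x).2.1 (enum_val x).2.2.
have : kermx B != 0.
  rewrite -mxrank_eq0 mxrank_ker subn_eq0 -ltnNge.
  by apply: leq_ltn_trans (rank_leq_col _) _; rewrite cJ.
case/rowV0Pn => a /sub_kermxP aB a0; case/eqP: a0.
apply/rowP => i; rewrite mxE; apply: (ind (fun i => a 0 i)) => v gv.
apply: (comb_graded mlin) gv => p; apply/matrixP => b c; rewrite mxE.
have /matrixP/(_ 0 (enum_rank ((p, (b, c)) : J))) := aB.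
rewrite !mxE => E; rewrite -[RHS]E /comb summxE; apply: eq_bigr => i' _.
by rewrite !mxE enum_rankK.
Qed.

Lemma card_choices : (#|{: choices}| <=
  t ^ k * (t./2).*2 ^ l * (n * #|generator t| + 1) ^ W)%N.
Proof.
by rewrite !card_prod !card_ffun card_option !card_prod card_bool !card_ord muln2 addn1.
Qed.

Lemma codim_upper : (codim F t kd k l <=
  (n * #|generator t| + 1) ^ W * W ^ 2 * (t ^ k * (t./2).*2 ^ l))%N.
Proof.
apply: codim_le => r /independent_upper /leq_trans; apply.
rewrite [X in (_ <= X)%N]mulnC mulnA leq_mul2r; apply/orP; right.
exact: card_choices.
Qed.

End CodimUpper.

(** * Left-normed words *)

Section LeftNormed.
Variables (F : fieldType) (N : nat).

Definition word_val (V : Type) (f : V -> 'M[F]_N * bool) (w : seq V) : 'M[F]_N * bool :=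
  if w is x :: s then foldl (@superbr F N) (f x) (map f s) else (0, false).

Lemma word_val_cat (V : eqType) (f : V -> 'M[F]_N * bool) (w w' : seq V) : w != [::] ->
  word_val f (w ++ w') = foldl (@superbr F N) (word_val f w) (map f w').
Proof. by case: w => // x s _; rewrite /= map_cat foldl_cat. Qed.

Definition word_tree (w : seq nat) : tree :=
  if w is x :: s then foldl Node (Leaf x) (map Leaf s) else Leaf 0.

Lemma leaves_word_tree w : w != [::] -> leaves (word_tree w) = w.
Proof.
case: w => // x s _ /=; rewrite -[RHS]/([:: x] ++ s) -[[:: x]]/(leaves (Leaf x)).
move: (Leaf x) => m; elim: s m => [|y s IH] m /=; first by rewrite cats0.
by rewrite IH /= -catA.
Qed.

Lemma eval_word_tree v par w : w != [::] ->
  eval_super v par (word_tree w) = word_val (fun i => (v i : 'M[F]_N, par i)) w.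
Proof.
case: w => // x s _ /=; rewrite -[(v x, par x)]/(eval_super v par (Leaf x)).
by move: (Leaf x) => m; elim: s m => //= y s IH m; rewrite IH eval_superN.
Qed.

Lemma word_val_map (V V' : Type) (f : V' -> 'M[F]_N * bool) (g : V -> V') w :
  word_val f (map g w) = word_val (f \o g) w.
Proof. by case: w => //= x s; rewrite -map_comp. Qed.

Lemma eq_word_val (V : eqType) (f f' : V -> 'M[F]_N * bool) w :
  {in w, f =1 f'} -> word_val f w = word_val f' w.
Proof.
case: w => //= x s h; rewrite h ?inE ?eqxx //; congr foldl.
by apply/eq_in_map => y ys; rewrite h // inE ys orbT.
Qed.

End LeftNormed.

(** * Independence from a dual system of substitutions *)

Section WordsLower.
Variables (F : fieldType) (t : nat) (kd : inv_kind).
Variables VE VO J : finType.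
Local Notation V := (VE + VO)%type.
Local Notation k := #|VE|.
Local Notation l := #|VO|.
Local Notation n := (k + l)%N.

Definition var_par (v : V) : bool := if v is inr _ then true else false.

Variables (w : J -> seq V) (u : J -> V -> 'M[F]_(t + t)).
Hypothesis w_uniq : forall j, uniq (w j).
Hypothesis w_mem : forall j v, v \in w j.
Hypothesis V_nonempty : (0 < n)%N.
Hypothesis u_graded : forall j v, if var_par v then S_odd kd (u j v) else S_even kd (u
  j v).
Local Notation value i j := (word_val (fun v => (u j v, var_par v)) (w i)).1.
Hypothesis value_diag : forall j, value j j != 0.
Hypothesis value_offdiag : forall i j, i != j -> value i j = 0.

(** Even variables are numbered first, as the convention of [gpar] demands. *)
Definition enc (v : V) : 'I_n :=
  match v with
  | inl e => lshift l (enum_rank e)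
  | inr o => rshift k (enum_rank o)
  end.

Definition dec (i : 'I_n) : V :=
  match fintype.split i with
  | inl e => inl (enum_val e)
  | inr o => inr (enum_val o)
  end.

Lemma encK : cancel enc dec.
Proof.
by case=> x; rewrite /dec /=;
  [rewrite -[lshift _ _]/(unsplit (inl _))|rewrite -[rshift _ _]/(unsplit (inr _))];
  rewrite unsplitK enum_rankK.
Qed.

Lemma decK : cancel dec enc.
Proof. by move=> i; rewrite /dec; case: split_ordP => j -> /=; rewrite enum_valK. Qed.

Lemma var_par_dec i : var_par (dec i) = (k <= i)%N.
Proof.
rewrite /dec; case: split_ordP => j -> /=; first by rewrite leqNgt ltn_ord.
by rewrite leq_addr.
Qed.

(** Evaluating a linear relation at [u j] leaves only the [j]-th coefficient times a nonzero
    matrix. *)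
Lemma words_independent : independent_family F t kd k l #|J|.
Proof.
have nil j : [seq val (enc v) | v <- w j] != [::].
  have := w_mem j (dec (Ordinal V_nonempty)); by case: (w j).
have mlin j : multilin n (word_tree [seq val (enc v) | v <- w j]).
  rewrite /multilin leaves_word_tree // -val_enum_ord (map_comp val enc) perm_map //.
  apply: uniq_perm; rewrite ?enum_uniq ?map_inj_uniq //; first exact: can_inj encK.
  by move=> i; rewrite mem_enum inE -[i]decK map_f.
exists (fun i => word_tree [seq val (enc v) | v <- w (enum_val i)]); split=> // a ha i.
pose v (i' : nat) := oapp (fun i' => u (enum_val i) (dec i')) 0 (insub i').
have vE x : v (val (enc x)) = u (enum_val i) x by rewrite /v valK /= encK.
have := ha v; rewrite (bigD1 i) //= big1 ?addr0.
  rewrite eval_word_tree // word_val_map.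
  rewrite (eq_word_val (f' := fun x => (u (enum_val i) x, var_par x))); last first.
    by move=> x _; rewrite /= vE /gpar -var_par_dec encK.
  move=> h; apply/eqP; move: (value_diag (enum_val i)); apply: contraR => ai.
  rewrite -[X in X == 0]scale1r -(mulVf ai) -scalerA h ?scaler0 // => i' i'n.
  have -> : v i' = u (enum_val i) (dec (Ordinal i'n)).
    by rewrite /v insubT /=.
  have := u_graded (enum_val i) (dec (Ordinal i'n)).
  by rewrite var_par_dec leqNgt /=; case: ltnP.
move=> i' i'i; rewrite eval_word_tree // word_val_map.
rewrite (eq_word_val (f' := fun x => (u (enum_val i) x, var_par x))); last first.
  by move=> x _; rewrite /= vE /gpar -var_par_dec encK.
by rewrite value_offdiag ?scaler0 // (inj_eq enum_val_inj).
Qed.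

End WordsLower.

(** * Brackets in the superalgebra *)

Section Brackets.
Variables (F : fieldType) (t : nat) (kd : inv_kind).
Implicit Types x y z : 'M[F]_t.

(** This makes both involutions one formula: the flip conjugated by a diagonal of signs. *)
Definition star_sign (i : 'I_t) : F := if kd is Symp then dsgn F i else 1.

Lemma starE x i j :
  star kd x i j = star_sign i * x (rev_ord j) (rev_ord i) * star_sign j.
Proof. by rewrite /star_sign; case: kd; rewrite /= !mxE ?mul1r ?mulr1. Qed.

Lemma star_sign_sqr i : star_sign i * star_sign i = 1.
Proof. by rewrite /star_sign; case: kd; rewrite ?mulr1 ?dsgn_sqr. Qed.

Lemma starM x y : star kd (x * y) = star kd y * star kd x.
Proof.
apply/matrixP => i j; rewrite starE -!mulmxE !mxE mulr_sumr mulr_suml.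
rewrite (reindex_inj rev_ord_inj) /=; apply: eq_bigr => c _; rewrite !starE.
rewrite -[x _ _ in LHS]mul1r -(star_sign_sqr c); ring.
Qed.

Lemma starB x y : star kd (x - y) = star kd x - star kd y.
Proof. by apply/matrixP => i j; rewrite !mxE !starE !mxE; ring. Qed.

Lemma star_delta a b :
  star kd (delta_mx a b) =
  (star_sign (rev_ord b) * star_sign (rev_ord a)) *: delta_mx (rev_ord b) (rev_ord a).
Proof.
apply/matrixP => i j; rewrite starE !mxE !rev_ord_eq andbC.
case: eqP => [->|]; last by rewrite /= mulr0 mul0r mulr0.
by case: eqP => [->|]; rewrite /= ?mulr1 // mulr0 mul0r mulr0.
Qed.

Definition Xm x : 'M[F]_(t + t) := block_mx x 0 0 (- star kd x).
Definition Ym y : 'M[F]_(t + t) := block_mx 0 y 0 0.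
Definition Zm z : 'M[F]_(t + t) := block_mx 0 0 z 0.

Let mxE' := (mulmx_block, opp_block_mx, add_block_mx, mulmx0, mul0mx, addr0, add0r,
  oppr0, mulmxN, mulNmx, @opprK).

Lemma superbr_XX x x' :
  superbr (Xm x, false) (Xm x', false) = (Xm (x * x' - x' * x), false).
Proof.
rewrite /superbr /= expr0 mul1r -!mulmxE /Xm !mxE' !mulmxE starB !starM.
by rewrite opprB addrC.
Qed.

Lemma superbr_XY x y :
  superbr (Xm x, false) (Ym y, true) = (Ym (x * y + y * star kd x), true).
Proof. by rewrite /superbr /= expr0 mul1r -!mulmxE /Xm /Ym !mxE'. Qed.

Lemma superbr_XZ x z :
  superbr (Xm x, false) (Zm z, true) = (Zm (- (star kd x * z + z * x)), true).
Proof. by rewrite /superbr /= expr0 mul1r -!mulmxE /Xm /Zm !mxE' opprD. Qed.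

Lemma superbr_YX x y :
  superbr (Ym y, true) (Xm x, false) = (Ym (- (x * y + y * star kd x)), true).
Proof.
by rewrite /superbr /= expr0 mul1r -!mulmxE /Xm /Ym !mxE' opprD addrC.
Qed.

Lemma superbr_ZX x z :
  superbr (Zm z, true) (Xm x, false) = (Zm (star kd x * z + z * x), true).
Proof. by rewrite /superbr /= expr0 mul1r -!mulmxE /Xm /Zm !mxE' addrC. Qed.

Lemma superbr_YY y y' : superbr (Ym y, true) (Ym y', true) = (0, false).
Proof. by rewrite /superbr /= expr1 mulN1r -!mulmxE /Ym !mxE' block_mx0. Qed.

Lemma superbr_ZZ y y' : superbr (Zm y, true) (Zm y', true) = (0, false).
Proof. by rewrite /superbr /= expr1 mulN1r -!mulmxE /Zm !mxE' block_mx0. Qed.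

Lemma superbr_YZ y z :
  superbr (Ym y, true) (Zm z, true) = (block_mx (y * z) 0 0 (z * y), false).
Proof. by rewrite /superbr /= expr1 mulN1r -!mulmxE /Ym /Zm !mxE'. Qed.

Lemma superbr_ZY y z :
  superbr (Zm z, true) (Ym y, true) = (block_mx (y * z) 0 0 (z * y), false).
Proof. by rewrite /superbr /= expr1 mulN1r -!mulmxE /Ym /Zm !mxE'. Qed.

End Brackets.

(** * Propagation of a vector along a word *)

Section Runs.
Variables (F : fieldType) (N : nat) (V : eqType).
Variables (f : V -> 'M[F]_N * bool) (mt : pred V).

(** Along the word the vector stays on prescribed lines, and of its scalar only the vanishing
    matters. Quantifying over the initial [c], zero included, makes the relation compose under
    concatenation. *)
Definition runs (A : 'M[F]_N) (pa : bool) (s : seq V) (B : 'M[F]_N) (pb : bool) : Prop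
  :=
  forall c, exists c', foldl (@superbr F N) (c *: A, pa) (map f s) = (c' *: B, pb)
                       /\ (c' != 0) = (c != 0) && all mt s.

Lemma runs_cat A pa s B pb s' C pc :
  runs A pa s B pb -> runs B pb s' C pc -> runs A pa (s ++ s') C pc.
Proof.
move=> h1 h2 c; have [c1 [E1 n1]] := h1 c; have [c2 [E2 n2]] := h2 c1.
by exists c2; rewrite map_cat foldl_cat E1 E2 all_cat andbA -n1.
Qed.

Lemma superbrZ (c : F) (A : 'M[F]_N) pa Q :
  superbr (c *: A, pa) Q = (c *: (superbr (A, pa) Q).1, (superbr (A, pa) Q).2).
Proof.
by rewrite /superbr /= scalerBr -!mulmxE -scalemxAl -!scalemxAr.
Qed.

Lemma runs1 A pa v B pb b : superbr (A, pa) (f v) = (b *: B, pb) ->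
  (b != 0) = mt v -> runs A pa [:: v] B pb.
Proof.
move=> E nb c; exists (c * b); rewrite /= superbrZ E scalerA /= andbT.
by rewrite mulf_eq0 negb_or nb.
Qed.

Lemma runs2 A pa v v' B pb b : superbr (superbr (A, pa) (f v)) (f v') = (b *: B, pb) ->
  (b != 0) = mt v && mt v' -> runs A pa [:: v; v'] B pb.
Proof.
move=> E nb c; exists (c * b); rewrite /= superbrZ superbrZ -surjective_pairing E.
by rewrite scalerA /= andbT mulf_eq0 negb_or nb.
Qed.

Lemma runs_flatten A pa (ss : seq (seq V)) :
  (forall s, s \in ss -> runs A pa s A pa) -> runs A pa (flatten ss) A pa.
Proof.
elim: ss => [|s ss IH] h /=.
  by move=> c; exists c; rewrite /= andbT.
apply: (runs_cat (h s _)); first by rewrite inE eqxx.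
by apply: IH => s' hs'; apply: h; rewrite inE hs' orbT.
Qed.

Lemma runs_stable A pa s :
  (forall v, v \in s -> runs A pa [:: v] A pa) -> runs A pa s A pa.
Proof.
move=> h; rewrite -[s]flatten_seq1; apply: runs_flatten => _ /mapP[v vs ->].
exact: h.
Qed.

End Runs.

(** * The word of the lower bound *)

Section Words.
Variables t0 s r : nat.
Local Notation t := t0.+2.
Local Notation m := (t0.+2./2).

(** [s] copies of each of the [t] even kinds, [t - 1] connecting variables, and [r] padding
    variables that adjust the total degree. *)
Definition evars : finType := (('I_t * 'I_s) + ('I_t0.+1 + 'I_r))%type.
Definition ovars : finType := ((('I_m * bool) * 'I_s) + unit)%type.
Definition vars : finType := (evars + ovars)%type.

Definition even_var (c : 'I_t) (j : 'I_s) : vars := inl (inl (c, j)).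
Definition conn_var (q : nat) : vars := inl (inr (inl (inord q))).
Definition extra_var (j : 'I_r) : vars := inl (inr (inr j)).
Definition odd_var (c : 'I_m * bool) (j : 'I_s) : vars := inr (inl (c, j)).
Definition last_odd_var : vars := inr (inr tt).

Definition even_block (c : 'I_t) : seq vars := map (even_var c) (enum 'I_s).
Definition odd_block (p : 'I_m) : seq vars :=
  flatten [seq [:: odd_var (p, true) j; odd_var (p, false) j] | j <- enum 'I_s].
(** Only even [q] give intervals symmetric about the centre, on which the odd pair numbered [q./2]
    acts. *)
Definition body (q : nat) : seq vars :=
  even_block (inord q) ++ (if odd q then [::] else odd_block (inord q./2)).
(* Stages are played in decreasing order of [q], each opened by the connecting
   variable that enlarges the interval of the previous one. *)
Definition stage (q : nat) : seq vars := conn_var q :: body q.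
Fixpoint stages (i : nat) : seq vars :=
  if i is i'.+1 then stages i' ++ stage (t0 - i) else stage t0.
(** The final odd variable turns the corner [e_1t] into an odd vector. It detects the last even
    kind, which has weight zero on all stages; the extra variables repeat that kind as padding. *)
Definition tail_block : seq vars :=
  last_odd_var :: even_block ord_max ++ map extra_var (enum 'I_r).
Definition word : seq vars := stages t0 ++ tail_block.

(** A key that separates the stages from each other and from the tail, used to show that no variable
    is repeated. *)
Definition stage_index (v : vars) : nat :=
  match v with
  | inl (inl (c, _)) => c
  | inl (inr (inl q)) => q
  | inl (inr (inr _)) => t0.+1
  | inr (inl ((p, _), _)) => p.*2
  | inr (inr _) => t0.+1
  end.

Lemma mem_even_block c j : even_var c j \in even_block c.
Proof. by rewrite map_f // mem_enum. Qed.

Lemma mem_odd_block p b j : odd_var (p, b) j \in odd_block p.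
Proof.
apply/flattenP; exists [:: odd_var (p, true) j; odd_var (p, false) j].
  by rewrite (map_f (fun j => [:: odd_var (p, true) j; odd_var (p, false) j])) //
    mem_enum.
by rewrite !inE; case: b; rewrite eqxx ?orbT.
Qed.

Lemma stage_index_stage q : (q <= t0)%N -> {in stage q, forall v, stage_index v = q}.
Proof.
move=> qt v; rewrite inE => /orP[/eqP ->|]; first by rewrite /= inordK.
rewrite mem_cat => /orP[/mapP[j _ ->]|]; first by rewrite /= inordK //; lia.
case: ifP => // oq /flattenP[_ /mapP[j _ ->]].
have lt : (q./2 < (t0./2).+1)%N by lia.
have pE : (inord q./2 : 'I_m) = q./2 :> nat := inordK lt.
by rewrite !inE => /orP[] /eqP -> /=; rewrite pE; lia.
Qed.

Lemma uniq_flatten_by (T S : eqType) (g : T -> S) (ss : seq (seq T)) (ks : seq S) :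
  uniq ks -> size ss = size ks -> all uniq ss ->
  all2 (fun s k => all (fun x => g x == k) s) ss ks -> uniq (flatten ss).
Proof.
elim: ss ks => //= s1 ss IH [|k1 ks] //= /andP[kn ku] [sz] /andP[us uss] /andP[h1 h2].
rewrite cat_uniq us (IH ks) // andbT; apply/hasPn => x /flattenP[s2 hs2 xs2].
apply/negP => xs1; case/negP: kn; have /eqP <- := allP h1 _ xs1.
elim: ss ks {IH uss ku sz} hs2 h2 => //= s3 ss IH [|k2 ks] //=.
rewrite !inE => /orP[/eqP <-|hs] /andP[h3 h4]; last by rewrite (IH ks) ?orbT.
by have /eqP -> := allP h3 _ xs2; rewrite eqxx.
Qed.

Lemma uniq_even_block c : uniq (even_block c).
Proof. by rewrite map_inj_uniq ?enum_uniq // => i j [->]. Qed.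

Lemma uniq_odd_block p : uniq (odd_block p).
Proof.
apply: (@uniq_flatten_by _ _ (fun v : vars => if v is inr (inl (_, j)) then Some j else
  None)
   _ (map some (enum 'I_s))).
- by rewrite map_inj_uniq ?enum_uniq // => i j [->].
- by rewrite !size_map.
- by rewrite all_map; apply/allP => j _ /=; rewrite inE andbT; apply/eqP => -[].
- by elim: (enum _) => //= j js ->; rewrite !eqxx.
Qed.

Lemma uniq_stage q : uniq (stage q).
Proof.
rewrite /stage /= /body cat_uniq uniq_even_block mem_cat negb_or /= -andbA.
apply/and4P; split.
- by apply/mapP => -[].
- by case: ifP => // _; apply/negP => /flattenP[_ /mapP[j _ ->]]; rewrite !inE.
- apply/hasPn => v; case: ifP => // _ /flattenP[_ /mapP[j _ ->]].
  by rewrite !inE => /orP[] /eqP ->; apply/mapP => -[].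
- by case: ifP => // _; exact: uniq_odd_block.
Qed.

Lemma stage_index_stages i : (i <= t0)%N -> {in stages i, forall v, (t0 - i <=
  stage_index v <= t0)%N}.
Proof.
elim: i => [|i IH] it v; first by move/stage_index_stage => -> //; lia.
rewrite mem_cat => /orP[vs|vs]; first by have := IH (ltnW it) v vs; lia.
by rewrite (stage_index_stage _ vs); lia.
Qed.

Lemma uniq_stages i : (i <= t0)%N -> uniq (stages i).
Proof.
elim: i => [|i IH] it; first exact: uniq_stage.
rewrite [stages _]/(stages i ++ stage (t0 - i.+1)) cat_uniq.
rewrite IH ?uniq_stage ?andbT ?andTb; last exact: ltnW.
apply/hasPn => v vs; apply/negP => /(stage_index_stages (ltnW it)).
by rewrite (stage_index_stage _ vs); lia.
Qed.

Lemma uniq_word : uniq word.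
Proof.
rewrite cat_uniq uniq_stages //=; apply/andP; split.
  rewrite negb_or; apply/andP; split.
    by apply/negP => /(stage_index_stages (leqnn t0)) /=; lia.
  apply/hasPn => v vt; apply/negP => /(stage_index_stages (leqnn t0)).
  by move: vt; rewrite mem_cat => /orP[] /mapP[j _ ->] /=; lia.
rewrite mem_cat negb_or cat_uniq uniq_even_block map_inj_uniq ?enum_uniq /=; last by
  move=> i j [].
rewrite andbT; apply/andP; split; first by apply/andP; split; apply/mapP => -[].
by apply/hasPn => _ /mapP[j _ ->]; apply/mapP => -[].
Qed.

Lemma mem_stages q i v : (i <= t0)%N -> (t0 - i <= q <= t0)%N -> v \in stage q -> v \in
  stages i.
Proof.
elim: i => [|i IH] it qi vq; first by move: vq; have -> : q = t0 by lia.
rewrite mem_cat; have [->|qn] := eqVneq (t0 - i.+1)%N q; first by rewrite vq orbT.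
by rewrite IH //; lia.
Qed.

Lemma mem_word v : v \in word.
Proof.
rewrite mem_cat; case: v => [[[c j]|[q|j]]|[[[p b] j]|[]]].
- have [ct|ct] := ltnP c t0.+1.
    rewrite (@mem_stages c) //; first by lia.
    by rewrite inE mem_cat inord_val mem_even_block orbT.
  have -> : c = ord_max by apply: val_inj => /=; have := ltn_ord c; lia.
  by rewrite inE mem_cat mem_even_block !orbT.
- rewrite (@mem_stages q) //; first by have := ltn_ord q; lia.
  by rewrite inE /conn_var inord_val eqxx.
- by rewrite inE mem_cat map_f ?mem_enum ?orbT.
- rewrite (@mem_stages p.*2) //; first by have := ltn_ord p; lia.
  rewrite inE mem_cat odd_double doubleK inord_val [_ \in odd_block _]mem_odd_block.
  by rewrite !orbT.
- by rewrite inE eqxx orbT.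
Qed.

End Words.

Local Arguments star : simpl never.

Section Diagonal.
Variables (F : fieldType) (t : nat) (kd : inv_kind).

Definition diagm (a : 'I_t -> F) : 'M[F]_t := diag_mx (\row_i a i).

Lemma delta_diagm a i j : delta_mx i j * diagm a = a j *: delta_mx i j.
Proof.
rewrite -mulmxE mul_mx_diag; apply/matrixP => x y; rewrite !mxE.
by case: (x == i); case: (y =P j) => [->|_]; rewrite /= ?mulr0 ?mul0r // mulrC.
Qed.

Lemma diagm_delta a i j : diagm a * delta_mx i j = a i *: delta_mx i j.
Proof.
rewrite -mulmxE mul_diag_mx; apply/matrixP => x y; rewrite !mxE.
by case: (x =P i) => [->|_] //=; rewrite !mulr0.
Qed.

Lemma star_diagm a : star kd (diagm a) = diagm (a \o @rev_ord t).
Proof.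
apply/matrixP => i j; rewrite starE !mxE (inj_eq rev_ord_inj) eq_sym.
case: eqP => [->|_]; last by rewrite !mulr0n mulr0 mul0r.
by rewrite !mulr1n mulrAC star_sign_sqr mul1r.
Qed.

Lemma upper_diagm a : upper (diagm a).
Proof. by move=> i j ij; rewrite !mxE -val_eqE /= gtn_eqF // mulr0n. Qed.

Lemma upper_delta (i j : 'I_t) : (i <= j)%N -> upper (delta_mx i j : 'M[F]_t).
Proof.
move=> ij x y xy; rewrite mxE; case: (x =P i) => //= xi; case: (y =P j) => // yj.
by move: xy; rewrite xi yj ltnNge ij.
Qed.

Lemma S_even_Xm (x : 'M[F]_t) : upper x -> S_even kd (Xm kd x).
Proof. by move=> ux; exists x. Qed.

End Diagonal.

(** * The odd generators acting on the corners [e_pp'] *)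

Section Pairs.
Variables (F : fieldType) (t : nat) (kd : inv_kind).
Hypothesis hs : kd = Symp -> ~~ odd t.
Implicit Types p q : 'I_(t./2).

Definition corner p : 'M[F]_t := delta_mx (lower_place p) (rev_ord (lower_place p)).
Definition ysym p : 'M[F]_t :=
  delta_mx (lower_place p) (lower_place p) + delta_mx (rev_ord (lower_place p))
    (rev_ord (lower_place p)).
Definition zskew p : 'M[F]_t :=
  delta_mx (lower_place p) (lower_place p) - delta_mx (rev_ord (lower_place p))
    (rev_ord (lower_place p)).

Lemma odd_gen_true p : odd_gen F (p, true) = Ym (ysym p).
Proof. by []. Qed.

Lemma odd_gen_false p : odd_gen F (p, false) = Zm (zskew p).
Proof. by []. Qed.

Lemma lower_place_neq_rev p q : (lower_place p == rev_ord (lower_place q)) = false.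
Proof. by rewrite -val_eqE /=; have := ltn_ord p; have := ltn_ord q; lia. Qed.

Lemma rev_neq_lower_place p q : (rev_ord (lower_place p) == lower_place q) = false.
Proof. by rewrite eq_sym lower_place_neq_rev. Qed.

Lemma lower_place_eq p q : (lower_place p == lower_place q) = (p == q).
Proof. by rewrite -!val_eqE. Qed.

Let deltaM := (mulmxBl, mulmxBr, mulmxDl, mulmxDr, mul_delta_mx_cond,
  inj_eq (@rev_ord_inj t), lower_place_eq, lower_place_neq_rev, rev_neq_lower_place).

Lemma corner_ysym p q : corner p * ysym q = (p == q)%:R *: corner p.
Proof.
rewrite -mulmxE /corner /ysym !deltaM mulr0n add0r.
by case: eqP => [->|_]; rewrite ?scale1r ?scale0r.
Qed.

Lemma ysym_corner p q : ysym q * corner p = (p == q)%:R *: corner p.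
Proof.
rewrite -mulmxE /corner /ysym !deltaM mulr0n addr0 eq_sym.
by case: eqP => [->|_]; rewrite ?scale1r ?scale0r.
Qed.

Lemma corner_zskew p q : corner p * zskew q = - ((p == q)%:R *: corner p).
Proof.
rewrite -mulmxE /corner /zskew !deltaM mulr0n sub0r.
by case: eqP => [->|_]; rewrite ?scale1r ?scale0r.
Qed.

Lemma zskew_corner p q : zskew q * corner p = (p == q)%:R *: corner p.
Proof.
rewrite -mulmxE /corner /zskew !deltaM mulr0n subr0 eq_sym.
by case: eqP => [->|_]; rewrite ?scale1r ?scale0r.
Qed.

(** In the symplectic case [t] is even, so the two places of a pair lie in opposite halves and their
    signs multiply to [-1]. *)
Lemma star_corner p : star kd (corner p) = (if kd is Symp then -1 else 1) *: corner p.
Proof.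
rewrite star_delta rev_ordK /star_sign; case: kd hs => [_|ot]; first by rewrite mulr1.
have hp := ltn_ord p; rewrite /dsgn /= hp ifF ?mul1r //.
by have := ot erefl; lia.
Qed.

(* The corner [e_pp'] is symmetric for the orthogonal involution and skew for the
   symplectic one; this decides which of [y_p], [z_p] does not kill it. *)
Definition first_odd : bool := if kd is Symp then false else true.

(** The flag is renamed so that, for both involutions, [true] marks the generator moving the corner
    to [last_vec] and [false] the one moving it back. *)
Definition stage_odd (c : 'I_(t./2) * bool) : 'M[F]_(t + t) :=
  odd_gen F (c.1, c.2 == first_odd).

Definition last_vec p : 'M[F]_(t + t) :=
  if kd is Symp then Zm (corner p) else Ym (corner p).

Lemma stage_odd1 p q : superbr (Xm kd (corner p), false) (stage_odd (q, true), true) =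
  (((if kd is Symp then -2%:R else 2%:R) * (p == q)%:R) *: last_vec p, true).
Proof.
rewrite /stage_odd /first_odd /last_vec /=; case: kd (star_corner p) => /= sE.
  rewrite odd_gen_true superbr_XY sE scale1r corner_ysym ysym_corner -scalerDl.
  by rewrite /Ym scale_block_mx !scaler0 -mulr2n mulr_natl.
rewrite odd_gen_false superbr_XZ sE scaleN1r [X in Zm (- (X + _))]mulNr corner_zskew
  zskew_corner opprK.
rewrite /Zm scale_block_mx !scaler0 -scalerDl -scaleNr; congr (block_mx _ _ (_ *: _) _,
  _).
by rewrite mulNr mulr_natl mulr2n.
Qed.
Lemma stage_odd1_wrong p q :
  superbr (Xm kd (corner p), false) (stage_odd (q, false), true) = (0, true).
Proof.
rewrite /stage_odd /first_odd /=; case: kd (star_corner p) => /= sE.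
  rewrite odd_gen_false superbr_XZ sE scale1r corner_zskew zskew_corner addNr oppr0.
  by rewrite /Zm block_mx0.
rewrite odd_gen_true superbr_XY sE scaleN1r corner_ysym mulrN ysym_corner subrr.
by rewrite /Ym block_mx0.
Qed.


Lemma stage_odd2 p q : superbr (last_vec p, true) (stage_odd (q, false), true) =
  (((if kd is Symp then 1 else -1) * (p == q)%:R) *: Xm kd (corner p), false).
Proof.
rewrite /stage_odd /first_odd /last_vec /Xm; case: kd (star_corner p) => /= sE.
  rewrite odd_gen_false superbr_YZ corner_zskew zskew_corner sE scale1r.
  by rewrite scale_block_mx !scaler0 mulN1r !scaleNr scalerN opprK.
rewrite odd_gen_true superbr_ZY corner_ysym ysym_corner sE scaleN1r opprK mul1r.
by rewrite scale_block_mx !scaler0.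
Qed.

Lemma stage_odd2_wrong p q :
  superbr (last_vec p, true) (stage_odd (q, true), true) = (0, false).
Proof.
rewrite /stage_odd /first_odd /last_vec; case: kd => /=.
  by rewrite odd_gen_true superbr_YY.
by rewrite odd_gen_false superbr_ZZ.
Qed.

(** A wrong index gives zero at once. A wrong flag makes the two terms cancel in the first step, and
    brackets two upper or two lower blocks in the second. *)
Lemma stage_odd_pair p c c' :
  superbr (superbr (Xm kd (corner p), false) (stage_odd c, true)) (stage_odd c', true) =
  ((- 2%:R * ((c == (p, true)) && (c' == (p, false)))%:R) *: Xm kd (corner p), false).
Proof.
have br0 pa Q : superbr (0, pa) Q = (0, pa (+) Q.2) :> 'M[F]_(t + t) * bool.
  by rewrite /superbr /= -!mulmxE mul0mx !mulmx0 subr0.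
case: c c' => q [] [q' []]; rewrite !xpair_eqE ?andbF ?andbT ?mulr0 ?scale0r.
- by rewrite stage_odd1 superbrZ stage_odd2_wrong scaler0.
- rewrite stage_odd1 superbrZ stage_odd2 /= scalerA (eq_sym q) (eq_sym q').
  congr (_ *: _, _); case: (p == q); case: (p == q') => /=; case: kd; ring.
- by rewrite stage_odd1_wrong br0.
- by rewrite stage_odd1_wrong br0.
Qed.

(** The final weight reads [a] at [p] in the orthogonal case and at [p'] in the symplectic one; for
    the outer pair this place is [base_end]. *)
Lemma last_vec_diag p a : superbr (last_vec p, true) (Xm kd (diagm a), false) =
  ((if kd is Symp then 2%:R * a (rev_ord (lower_place p)) else - (2%:R * a (lower_place
    p))) *: last_vec p, true).
Proof.
rewrite /last_vec; case: kd.
  rewrite superbr_YX star_diagm diagm_delta delta_diagm /= rev_ordK -scalerDl.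
  by rewrite /Ym scale_block_mx !scaler0 -scaleNr -mulr2n mulr_natl.
rewrite superbr_ZX star_diagm diagm_delta delta_diagm /= -scalerDl.
by rewrite /Zm scale_block_mx !scaler0 -mulr2n mulr_natl.
Qed.

Lemma S_odd_stage_odd c : S_odd kd (stage_odd c).
Proof.
have dE (q : 'I_t) : star kd (delta_mx q q : 'M[F]_t) = delta_mx (rev_ord q) (rev_ord
  q).
  by rewrite star_delta star_sign_sqr scale1r.
have starD x y : star kd (x + y) = star kd x + star kd y :> 'M[F]_t.
  by apply/matrixP => i j; rewrite !mxE !starE !mxE; ring.
have up0 : upper (0 : 'M[F]_t) by move=> i j _; rewrite mxE.
have s0 : star kd 0 = 0 :> 'M[F]_t by rewrite -[X in star kd X](subrr (0 : 'M[F]_t))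
  starB subrr.
have uy p : upper (ysym p) by move=> i j ij; rewrite mxE !upper_delta ?addr0.
have uz p : upper (zskew p) by move=> i j ij; rewrite mxE upper_delta // mxE
  upper_delta // oppr0 addr0.
rewrite /stage_odd; case: (_ == _); [rewrite odd_gen_true|rewrite odd_gen_false].
  exists (ysym c.1), 0; split=> //; rewrite ?s0 ?oppr0 //.
  by rewrite /ysym starD !dE rev_ordK addrC.
exists 0, (zskew c.1); split=> //.
by rewrite /zskew starB !dE rev_ordK opprB.
Qed.

Lemma last_vec_neq0 p : last_vec p != 0.
Proof.
apply/eqP => /matrixP; rewrite /last_vec; case: kd.
  move=> /(_ (lshift t (lower_place p)) (rshift t (rev_ord (lower_place p)))).
  by rewrite block_mxEur !mxE !eqxx => /eqP; rewrite oner_eq0.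
move=> /(_ (rshift t (lower_place p)) (lshift t (rev_ord (lower_place p)))).
by rewrite block_mxEdl !mxE !eqxx => /eqP; rewrite oner_eq0.
Qed.

End Pairs.

(** * Evaluation of the words *)

Section WordValues.
Variables (F : fieldType) (t0 : nat) (kd : inv_kind) (s r : nat).
Local Notation t := t0.+2.
Local Notation m := (t0.+2./2).
Hypothesis h2 : 2%:R != 0 :> F.
Hypothesis hs : kd = Symp -> ~~ odd t.

Definition outer_pair : 'I_m := (ord0 : 'I_(t0./2).+1).

(* [lo q] and [hi q] bound what remains of the [t] places after removing [q] of
   them alternately from the left and from the right. *)
Definition lo (q : nat) : 'I_t := inord q.+1./2.
Definition hi (q : nat) : 'I_t := rev_ord (inord q./2).

Lemma val_lo q : (q <= t0)%N -> lo q = q.+1./2 :> nat.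
Proof. by move=> qt; rewrite inordK //; lia. Qed.

Lemma val_hi q : (q <= t0)%N -> hi q = (t0.+1 - q./2)%N :> nat.
Proof. by move=> qt; rewrite /= inordK //; lia. Qed.

Lemma ord_eqE (i j : 'I_t) : (i == j) = (i == j :> nat).
Proof. by []. Qed.

(** The innermost interval, [q = t0], opens the word with its own matrix unit; each later one adds a
    place, on the right for odd [q] and on the left for even [q]. *)
Definition conn_mx (q : nat) : 'M[F]_t :=
  if q == t0 then delta_mx (lo q) (hi q)
  else if odd q then delta_mx (hi q.+1) (hi q) else delta_mx (lo q) (lo q.+1).

Definition stage_vec (q : nat) : 'M[F]_(t + t) := Xm kd (delta_mx (lo q) (hi q)).

Definition base_end : 'I_t := if kd is Symp then rev_ord ord0 else ord0.

(* Up to nonzero factors, [weight_fun] is the basis dual to the weights of the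
   stages and of the final odd vector. The weight of a stage is the difference of
   the values at the two ends of its interval, so an indicator function of the
   next smaller interval is detected by a single stage; the subtracted constant
   makes the final weight vanish. *)
Definition step_fun (c : nat) (i : 'I_t) : bool :=
  (c.+2./2 <= i)%N && (i + c.+1./2 <= t0.+1)%N.

Definition weight_fun (c : 'I_t) (i : 'I_t) : F :=
  if (c < t0.+1)%N then (step_fun c i)%:R - (step_fun c base_end)%:R else 1.

Lemma bool_diff_neq0 (b b' : bool) : (b%:R - b'%:R != 0 :> F) = (b != b').
Proof. by case: b b' => [] []; rewrite ?subrr ?subr0 ?sub0r ?oppr_eq0 ?eqxx ?oner_eq0.
  Qed.

(** [step_fun c] is the indicator of the interval following stage [c] inwards. The ends of stage [q]
    both lie inside for [q > c] and both outside for [q < c]; for [q = c] exactly one is inside. *)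
Lemma weight_stage q (c : 'I_t) : (q <= t0)%N ->
  (weight_fun c (hi q) - weight_fun c (lo q) != 0) = (c == q :> nat).
Proof.
move=> qt; rewrite /weight_fun; case: ifP => ct; last first.
  by rewrite subrr eqxx; apply/esym/negbTE; lia.
rewrite opprB addrA subrK bool_diff_neq0 /step_fun val_lo // val_hi //.
move: (nat_of_ord c) ct => {}c ct.
by case: (ltngtP c q) => h; lia.
Qed.

Lemma weight_end (c : 'I_t) : (weight_fun c base_end != 0) = (c == t0.+1 :> nat).
Proof.
rewrite /weight_fun; case: ifP => ct; first by rewrite subrr eqxx; apply/esym/negbTE;
  lia.
by rewrite oner_eq0; apply/esym; have := ltn_ord c; lia.
Qed.

Section Substitution.
Variables (phi_e : 'I_t * 'I_s -> 'I_t) (phi_o : ('I_m * bool) * 'I_s -> 'I_m * bool).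
Local Notation vars := (vars t0 s r).

Definition subst_value (v : vars) : 'M[F]_(t + t) :=
  match v with
  | inl (inl x) => Xm kd (diagm (weight_fun (phi_e x)))
  | inl (inr (inl q)) => Xm kd (conn_mx q)
  | inl (inr (inr _)) => Xm kd (diagm (weight_fun ord_max))
  | inr (inl x) => stage_odd F kd (phi_o x)
  | inr (inr _) => stage_odd F kd (outer_pair, true)
  end.

Definition matched (v : vars) : bool :=
  match v with
  | inl (inl x) => phi_e x == x.1
  | inr (inl x) => phi_o x == x.1
  | _ => true
  end.

Local Notation f := (fun v => (subst_value v, var_par v)).
Local Notation runs := (runs f matched).

Lemma subst_value_graded v :
  if var_par v then S_odd kd (subst_value v) else S_even kd (subst_value v).
Proof.
case: v => [[x|[q|x]]|[x|x]] /=; try exact: S_odd_stage_odd;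
  try by apply: S_even_Xm; exact: upper_diagm.
apply/S_even_Xm; rewrite /conn_mx; have qt := ltn_ord q.
case: eqP => [q0|/eqP q0]; first by apply: upper_delta; rewrite val_lo ?val_hi //; lia.
have qt1 : (q.+1 <= t0)%N by lia.
by case: ifP => _; apply: upper_delta; rewrite ?val_lo ?val_hi //; lia.
Qed.

Lemma runs_even_block q : (q <= t0)%N ->
  runs (stage_vec q) false (even_block s r (inord q)) (stage_vec q) false.
Proof.
move=> qt; apply: runs_stable => _ /mapP[j _ ->].
apply: (@runs1 _ _ _ _ _ _ _ _ _ _ (weight_fun (phi_e (inord q, j)) (hi q) - weight_fun
  (phi_e (inord q, j)) (lo q))).
  rewrite superbr_XX delta_diagm diagm_delta -scalerBl /stage_vec; congr (_, _).
  by rewrite /Xm scale_block_mx !scaler0 scalerN; congr block_mx; congr (- _);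
    apply/matrixP => i j'; rewrite mxE !starE mxE; ring.
by rewrite weight_stage //= -val_eqE /= inordK //; lia.
Qed.

Lemma stage_vec_corner q : (q <= t0)%N -> ~~ odd q ->
  stage_vec q = Xm kd (corner F (inord q./2 : 'I_m)).
Proof.
move=> qt oq; rewrite /stage_vec /corner.
have lt : (q./2 < (t0./2).+1)%N by lia.
have pE : (inord q./2 : 'I_m) = q./2 :> nat := inordK lt.
have -> : lo q = lower_place (inord q./2 : 'I_m) by apply: ord_inj; rewrite val_lo //=
  pE; lia.
have -> // : hi q = rev_ord (lower_place (inord q./2 : 'I_m)).
by apply: ord_inj; rewrite val_hi //= pE; lia.
Qed.

Lemma runs_odd_block q : (q <= t0)%N -> ~~ odd q ->
  runs (stage_vec q) false (odd_block s r (inord q./2)) (stage_vec q) false.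
Proof.
move=> qt oq; rewrite (stage_vec_corner qt oq).
apply: runs_flatten => _ /mapP[j _ ->].
apply: runs2; first exact: stage_odd_pair.
rewrite /= mulf_eq0 oppr_eq0 (negbTE h2) /=.
by case: (_ && _); rewrite ?oner_eq0 ?eqxx.
Qed.

Lemma runs_conn q : (q < t0)%N ->
  runs (stage_vec q.+1) false [:: conn_var t0 s r q] (stage_vec q) false.
Proof.
move=> qt.
(* One product of the bracket survives; adding a place on the left multiplies from the left, whence
   the sign [-1]. *)
apply: (@runs1 _ _ _ _ _ _ _ _ _ _ (if odd q then 1 else -1)); last first.
  by case: ifP; rewrite ?oppr_eq0 oner_eq0.
have Xscale a (x : 'M[F]_t) : a *: Xm kd x = Xm kd (a *: x).
  rewrite /Xm scale_block_mx !scaler0 scalerN; congr block_mx; congr (- _).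
  by apply/matrixP => i j'; rewrite mxE !starE mxE; ring.
rewrite /= inordK 1?ltnS; last exact: ltnW.
rewrite superbr_XX /stage_vec Xscale /conn_mx ltn_eqF // -!mulmxE; congr (Xm _ _, _).
have hl : (hi q == lo q) = false.
  by apply/negbTE; rewrite ord_eqE val_hi ?val_lo //; lia.
case: ifP => oq; rewrite !mul_delta_mx_cond.
  have -> : lo q.+1 = lo q by apply: ord_inj; rewrite !val_lo //; lia.
  by rewrite eqxx hl mulr0n mulr1n subr0 scale1r.
have -> : hi q.+1 = hi q by apply: ord_inj; rewrite !val_hi //; lia.
by rewrite eqxx hl mulr0n mulr1n sub0r scaleN1r.
Qed.

Lemma runs_body q : (q <= t0)%N ->
  runs (stage_vec q) false (body t0 s r q) (stage_vec q) false.
Proof.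
move=> qt; apply: runs_cat; first exact: runs_even_block.
case: ifP => oq; last by apply: runs_odd_block; rewrite ?oq.
by move=> c; exists c; rewrite /= andbT.
Qed.

Lemma stages_neq0 i : stages t0 s r i != [::].
Proof. by elim: i => //= i; case: (stages t0 s r i). Qed.

Lemma value_stages i : (i <= t0)%N ->
  exists c, word_val f (stages t0 s r i) = (c *: stage_vec (t0 - i), false)
    /\ (c != 0) = all matched (stages t0 s r i).
Proof.
elim: i => [_|i IH it].
  rewrite subn0 /= inordK // /conn_mx eqxx -/(stage_vec t0).
  have [c [E n]] := runs_body (leqnn t0) 1.
  by exists c; rewrite scale1r in E; rewrite E n oner_eq0.
have [c [E n]] := IH (ltnW it).
have tE : (t0 - i = (t0 - i.+1).+1)%N by lia.
rewrite tE in E.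
have lt1 : (t0 - i.+1 < t0)%N by lia.
have [c' [E' n']] := runs_cat (runs_conn lt1) (runs_body (ltnW lt1)) c.
exists c'; rewrite [stages _ _ _ _]/(stages t0 s r i ++ stage t0 s r (t0 - i.+1)).
rewrite word_val_cat; last exact: stages_neq0.
by rewrite E all_cat -n -n'.
Qed.

Lemma value_word : exists c,
  word_val f (word t0 s r) = (c *: last_vec F kd outer_pair, true)
  /\ (c != 0) = all matched (word t0 s r).
Proof.
have [c [E n]] := value_stages (leqnn t0).
have corner0 : stage_vec (t0 - t0) = Xm kd (corner F outer_pair).
  rewrite subnn stage_vec_corner //; congr (Xm _ (corner _ _)); apply: ord_inj.
  exact: (@inordK _ 0).
rewrite corner0 in E.
(* Every weight function acts on the final odd vector by a scalar, which is nonzero exactly for the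
   last even kind. *)
have ends (b : 'I_t) v : subst_value v = Xm kd (diagm (weight_fun b)) -> var_par v =
  false ->
    matched v = (b == t0.+1 :> nat) ->
    runs (last_vec F kd outer_pair) true [:: v] (last_vec F kd outer_pair) true.
  move=> vE pE mE; apply: runs1; first by rewrite vE pE; exact: last_vec_diag.
  rewrite mE -weight_end /base_end; have r0 : lower_place outer_pair = ord0 by apply:
    ord_inj.
  by case: kd; rewrite r0 ?oppr_eq0 mulf_eq0 (negbTE h2).
have rt : runs (Xm kd (corner F outer_pair)) false (tail_block t0 s r) (last_vec F kd
  outer_pair) true.
  rewrite /tail_block -cat1s; apply: (@runs_cat _ _ _ _ _ _ _ _ (last_vec F kd
    outer_pair) true).
    apply: runs1; first exact: stage_odd1.
    by rewrite eqxx mulr1 /=; case: kd; rewrite ?oppr_eq0.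
  apply: runs_stable => v; rewrite mem_cat => /orP[] /mapP[j _ ->].
    apply: (ends (phi_e (ord_max, j))) => //=; rewrite -val_eqE //=.
  by apply: (ends ord_max) => //=; rewrite eqxx.
have [c' [E' n']] := rt c.
exists c'; rewrite word_val_cat; last exact: stages_neq0.
by rewrite E E' all_cat -n -n'.
Qed.

End Substitution.
End WordValues.

(** * Bounds on the graded codimensions *)

Section LowerBound.
Variables (F : fieldType) (t0 : nat) (kd : inv_kind).
Local Notation t := t0.+2.
Local Notation m := (t0.+2./2).
Hypothesis h2 : 2%:R != 0 :> F.
Hypothesis hs : kd = Symp -> ~~ odd t.

Section Fixed.
Variables s r : nat.

Definition even_index : finType := {phi : {ffun 'I_t * 'I_s -> 'I_t} | phi \in balanced
  'I_t s}.
Definition odd_index : finType :=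
  {phi : {ffun ('I_m * bool) * 'I_s -> 'I_m * bool} | phi \in balanced ('I_m *
    bool)%type s}.

Definition index_perm (T : finType) (phi : {phi : {ffun T * 'I_s -> T} | phi \in
  balanced T s}) :
  {perm T * 'I_s} := projT1 (cid (balancedP (valP phi))).

Lemma index_permP (T : finType) (phi : {phi : {ffun T * 'I_s -> T} | phi \in balanced T
  s}) x :
  val phi (index_perm phi x) = x.1.
Proof. by rewrite /index_perm; case: cid. Qed.

(* The fixed (connecting and extra) variables are left in place. *)
Definition permute (j : even_index * odd_index) (v : vars t0 s r) : vars t0 s r :=
  match v with
  | inl (inl x) => inl (inl (index_perm j.1 x))
  | inr (inl x) => inr (inl (index_perm j.2 x))
  | _ => v
  end.

Lemma permute_inj j : injective (permute j).
Proof.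
by case=> [[x|x]|[x|x]] [[y|y]|[y|y]] //= [] /perm_inj ->.
Qed.

(** The word of index [i] is the fixed word with variables permuted so that the kinds given by [i]
    fall where they are expected; under the substitution of index [j] it survives only if [j]
    assigns the same kinds. *)
Lemma words_family : independent_family F t kd #|evars t0 s r| #|ovars t0 s|
  #|{: even_index * odd_index}|.
Proof.
pose u (j : even_index * odd_index) := subst_value F kd (r := r) (val j.1) (val j.2).
apply: (words_independent (w := fun j => map (permute j) (word t0 s r)) (u := u)).
- by move=> j; rewrite map_inj_uniq ?uniq_word //; exact: permute_inj.
- move=> j v; have [g gK Kg] := injF_bij (@permute_inj j).
  by rewrite -[v]Kg map_f ?mem_word.
- by rewrite [#|ovars _ _|]card_sum card_unit !addn1 addnS.
- by move=> j v; exact: subst_value_graded.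
- move=> j; rewrite word_val_map.
  have [c [E n]] := value_word r h2 hs (fun x => val j.1 (index_perm j.1 x)) (fun x =>
    val j.2 (index_perm j.2 x)).
  rewrite (eq_word_val (f' := fun v => (subst_value F kd (fun x => val j.1 (index_perm
    j.1 x))
     (fun x => val j.2 (index_perm j.2 x)) v, var_par v))); last by case=>
       [[x|x]|[x|x]] _.
  rewrite E /= scaler_eq0 negb_or last_vec_neq0 andbT n; apply/allP.
  by case=> [[x|x]|[x|x]] _ //=; rewrite index_permP.
- move=> i j ij; rewrite word_val_map.
  have [c [E n]] := value_word r h2 hs (fun x => val j.1 (index_perm i.1 x)) (fun x =>
    val j.2 (index_perm i.2 x)).
  rewrite (eq_word_val (f' := fun v => (subst_value F kd (fun x => val j.1 (index_perm
    i.1 x))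
     (fun x => val j.2 (index_perm i.2 x)) v, var_par v))); last by case=>
       [[x|x]|[x|x]] _.
  rewrite E /=; case: (eqVneq c 0) n => [->|c0]; first by rewrite scale0r.
  (* With every letter matched, the maps of [j] composed with the permutations of [i] equal [fst],
     which characterises the maps of [i]. *)
  move/esym/allP => h; case/eqP: ij.
  rewrite [i]surjective_pairing [j]surjective_pairing; congr (_, _);
    apply/val_inj/ffunP => x.
    rewrite -[x](permKV (index_perm i.1)) index_permP.
    by have /= /eqP -> := h (inl (inl ((index_perm i.1)^-1%g x))) (mem_word _).
  rewrite -[x](permKV (index_perm i.2)) index_permP.
  by have /= /eqP -> := h (inr (inl ((index_perm i.2)^-1%g x))) (mem_word _).
Qed.

End Fixed.

Local Notation D := (t + m.*2)%N.

Lemma bin_mono n k a b : ('C(n, k) <= 'C(n + (a + b), k + a))%N.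
Proof.
elim: a => [|a IH].
  rewrite add0n addn0; elim: b => [|b IH]; first by rewrite addn0.
  by apply: leq_trans IH _; rewrite addnS; exact: leq_bin2l.
by apply: leq_trans IH _; rewrite addSn !addnS binS leq_addl.
Qed.

Lemma cgr_ge_term n k : (k <= n)%N -> ('C(n, k) * codim F t kd k (n - k) <= cgr F t kd
  n)%N.
Proof.
move=> kn; have kn' : (k < n.+1)%N by [].
by rewrite /cgr (bigD1 (Ordinal kn')) //= leq_addr.
Qed.

(** A single term of the sum suffices: the binomial coefficient, at least ['C(D * s, t * s)], joins
    the two balanced counts [(ts)!/(s!)^t] and [(2ms)!/(s!)^(2m)] into [(Ds)!/(s!)^D]. *)
Lemma cgr_lower_fact s r :
  ((D * s)`! <= cgr F t kd (D * s + r + t) * s`! ^ D)%N.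
Proof.
set k := (t * s + (t0.+1 + r))%N; set l := (m.*2 * s + 1)%N.
have nE : (D * s + r + t = k + l)%N by rewrite /k /l; lia.
have cod : (#|balanced 'I_t s| * #|balanced ('I_m * bool)%type s| <= codim F t kd k
  l)%N.
  have H := words_family s r; move: H.
  rewrite !card_sum !card_prod !card_ord card_unit card_bool muln2 -/k -/l.
  rewrite !card_sig => H; apply: codim_ge H => r'; apply: independent_upper => //.
  by rewrite /k /l; lia.
have Be := card_balanced_lower 'I_t s; have Bo := card_balanced_lower ('I_m *
  bool)%type s.
rewrite card_ord in Be; rewrite card_prod card_ord card_bool muln2 in Bo.
have kn : (k <= D * s + r + t)%N by lia.
have := cgr_ge_term kn; have -> : (D * s + r + t - k = l)%N by lia.
move=> cg; apply: leq_trans (leq_mul (leq_trans (leq_mul _ cod) cg) (leqnn _)); last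
  first.
  exact: leqnn.
have bm : ('C(D * s, t * s) <= 'C(D * s + r + t, k))%N.
  have -> : (D * s + r + t = D * s + ((t0.+1 + r) + 1))%N by lia.
  exact: bin_mono.
apply: leq_trans (leq_mul (leq_mul bm (leqnn _)) (leqnn _)).
have ts : (t * s <= D * s)%N by rewrite leq_mul2r leq_addr orbT.
rewrite -[X in (X <= _)%N](bin_fact ts) -mulnA leq_mul2l; apply/orP; right.
have -> : (D * s - t * s = m.*2 * s)%N by rewrite mulnDl addKn.
by rewrite expnD mulnACA; exact: leq_mul.
Qed.

Lemma cgr_lower n : (t + D.*2 <= n)%N ->
  (D ^ n <= D ^ (t + D.*2) * n ^ D * cgr F t kd n)%N.
Proof.
move=> hn; have D0 : (0 < D)%N by [].
(* Here [n = D(s+1) + r + t] with [r < D], so [n - Ds] is below [t + 2D], which accounts for the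
   constant [D ^ (t + D.*2)]. *)
pose s := ((n - t) %/ D).-1; pose r := ((n - t) %% D)%N.
have r_lt : (r < D)%N by rewrite ltn_mod.
have nE := divn_eq (n - t) D.
have q0 : (0 < (n - t) %/ D)%N by rewrite divn_gt0 //; lia.
have sE : ((n - t) %/ D = s.+1)%N by rewrite prednK.
rewrite sE -/r in nE.
have nE' : (n = D * s.+1 + r + t)%N by lia.
have h1 := cgr_lower_fact s.+1 r; rewrite -nE' in h1.
have h3 := fact_balanced_lower D s.
have f0 : (0 < (s.+1)`! ^ D)%N by rewrite expn_gt0 fact_gt0.
have h4 : (D ^ (D * s) <= cgr F t kd n * s.+1 ^ D)%N.
  rewrite -(leq_pmul2l f0); apply: leq_trans h3 _.
  by rewrite mulnA (mulnC _ (cgr _ _ _ _)) leq_mul2r h1 orbT.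
have sn : (s.+1 <= n)%N by rewrite nE'; nia.
have le1 : (D ^ n <= D ^ (t + D.*2) * D ^ (D * s))%N.
  rewrite -expnD leq_pexp2l // nE'; nia.
apply: leq_trans le1 _; rewrite -mulnA leq_mul2l; apply/orP; right.
by apply: leq_trans h4 _; rewrite mulnC leq_mul2r leq_exp2r ?sn ?orbT.
Qed.

Lemma cgr_upper n : (0 < n)%N ->
  (cgr F t kd n <= (#|generator t|.+1 * n) ^ t.*2 * t.*2 ^ 2 * D ^ n)%N.
Proof.
move=> n0; apply: codim_bounds_total => k l kl.
have kl0 : (0 < k + l)%N by rewrite kl.
apply: leq_trans (codim_upper kd h2 _ kl0) _ => //; rewrite kl.
rewrite !leq_mul2r leq_exp2r //; apply/orP; right; apply/orP; right.
by nia.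
Qed.

End LowerBound.

(** * Passage to the limit *)

Local Open Scope classical_set_scope.

Section Limit.
Variable R : realType.

Lemma cvg_invn_cst (c : R) : (fun n : nat => c / n%:R) @ \oo --> (0 : R).
Proof.
apply/cvgr0Pnorm_lt => e e0; near=> n.
have n0 : (0 : R) < n%:R by near: n; exact: nbhs_infty_gtr.
rewrite normrM normfV (gtr0_norm n0) ltr_pdivrMr // mulrC -ltr_pdivrMr //.
by near: n; exact: nbhs_infty_gtr.
Unshelve. all: by end_near.
Qed.

(** From [1 + y^2/2 <= exp y] at [y = ln n] one gets [(ln n)^2 < 2n], which contradicts
    [ln n >= e n] once [n > 2/e^2]. *)
Lemma cvg_lnn : (fun n : nat => ln (n%:R : R) / n%:R) @ \oo --> (0 : R).
Proof.
apply/cvgr0Pnorm_lt => e e0; near=> n.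
have n1 : (1 : R) < n%:R by near: n; exact: nbhs_infty_gtr.
have n0 : (0 : R) < n%:R by exact: lt_trans n1.
have nbig : 2 / e ^+ 2 < n%:R by near: n; exact: nbhs_infty_gtr.
have y0 : 0 <= ln (n%:R : R) by apply: ln_ge0; exact: ltW.
rewrite ger0_norm ?divr_ge0 // ?(ltW n0) // ltr_pdivrMr //.
rewrite ltNge; apply/negP => le.
have := expR_ge1Dxn 1 y0; rewrite lnK ?posrE // => h.
have e2 : 0 < e ^+ 2 by rewrite exprn_gt0.
move: nbig; rewrite ltr_pdivrMr // => nbig.
have sq : (e * n%:R) ^+ 2 <= ln (n%:R : R) ^+ 2 by rewrite lerXn2r ?nnegrE ?mulr_ge0
  ?(ltW e0) ?(ltW n0).
have : 2 * n%:R < e ^+ 2 * n%:R ^+ 2 :> R.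
  by rewrite expr2 mulrA ltr_pM2r // mulrC.
rewrite -exprMn => /lt_le_trans /(_ sq).
rewrite (_ : 2`! = 2)%N // in h.
by move: h; move: (ln _ ^+ 2) => z; lra.
Unshelve. all: by end_near.
Qed.

Lemma cvg_log_error (A W : nat) :
  (fun n : nat => (ln (A%:R : R) + W%:R * ln (n%:R)) / n%:R) @ \oo --> (0 : R).
Proof.
rewrite (_ : (fun n : nat => _) =
  (fun n : nat => ln (A%:R : R) / n%:R + W%:R * (ln n%:R / n%:R))); last first.
  by apply/funext => n; rewrite mulrDl mulrA.
rewrite -[X in _ --> X](addr0 (0 : R)) -[X in _ --> _ + X](mulr0 (W%:R : R)).
apply: cvgD; first exact: cvg_invn_cst.
by apply: cvgMl_tmp; exact: cvg_lnn.
Qed.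

Lemma ln_natM (a b : nat) : (0 < a)%N -> (0 < b)%N ->
  ln ((a * b)%N%:R : R) = ln a%:R + ln b%:R.
Proof. by move=> a0 b0; rewrite natrM lnM // posrE ltr0n. Qed.

Lemma ln_natX (a n : nat) : (0 < a)%N -> ln ((a ^ n)%N%:R : R) = n%:R * ln a%:R.
Proof. by move=> a0; rewrite natrX lnXn ?ltr0n // mulr_natl. Qed.

Lemma ln_nat_le (a b : nat) : (0 < a)%N -> (a <= b)%N -> ln (a%:R : R) <= ln b%:R.
Proof.
move=> a0 ab; rewrite ler_ln ?posrE ?ltr0n ?ler_nat //; exact: leq_trans ab.
Qed.

(** Taking logarithms squeezes [ln (u n) / n] between [ln D] plus and minus errors of order
    [ln n / n]; continuity of the exponential then gives the root. *)
Lemma nth_root_limit (u : nat -> nat) (D A W B W' N : nat) : (0 < D)%N ->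
  (forall n, (N <= n)%N -> (D ^ n <= A * n ^ W * u n)%N) ->
  (forall n, (N <= n)%N -> (u n <= B * n ^ W' * D ^ n)%N) ->
  (fun n : nat => ((u n)%:R : R) `^ (n%:R)^-1) @ \oo --> (D%:R : R).
Proof.
move=> D0 lower upper.
have Dn0 n : (0 < D ^ n)%N by rewrite expn_gt0 D0.
have pos n : (N <= n)%N -> [/\ 0 < A, 0 < n ^ W, 0 < u n, 0 < B & 0 < n ^ W']%N.
  move=> /[dup] /lower h1 /upper h2.
  have : (0 < A * n ^ W * u n)%N by exact: leq_trans h1.
  rewrite !muln_gt0 => /andP[/andP[-> ->] u0]; rewrite u0.
  by have := leq_trans u0 h2; rewrite !muln_gt0 => /andP[/andP[-> ->] _].
have D0R : (D%:R : R) \is Num.pos by rewrite posrE ltr0n.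
rewrite -[X in _ --> X](lnK D0R).
have lim : (fun n : nat => ln ((u n)%:R : R) / n%:R) @ \oo --> ln (D%:R : R).
  apply: (squeeze_cvgr (f := fun n : nat => ln (D%:R : R) - (ln (A%:R : R) + W%:R * ln
    n%:R) / n%:R)
    (h := fun n : nat => ln (D%:R : R) + (ln (B%:R : R) + W'%:R * ln n%:R) / n%:R)).
  - near=> n.
    have Nn : (N <= n)%N by near: n; exact: nbhs_infty_ge.
    have n0 : (0 < n)%N by near: n; exact: nbhs_infty_gt.
    have n0R : (0 : R) < n%:R by rewrite ltr0n.
    have [A0 nW u0 B0 nW'] := pos n Nn.
    have h1 := ln_nat_le (Dn0 n) (lower n Nn).
    have h2 := ln_nat_le u0 (upper n Nn).
    rewrite !ln_natM ?muln_gt0 ?A0 ?B0 ?nW ?nW' // !ln_natX // in h1 h2.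
    have E : ln (D%:R : R) = n%:R * ln D%:R / n%:R by rewrite mulrAC mulfV ?mul1r
      ?gt_eqF.
    rewrite {1}E {2}E -mulrBl -mulrDl !ler_pM2r ?invr_gt0 //; apply/andP; split; lra.
  - rewrite -[X in _ --> X]subr0; apply: cvgB; first exact: cvg_cst.
    exact: cvg_log_error.
  - rewrite -[X in _ --> X]addr0; apply: cvgD; first exact: cvg_cst.
    exact: cvg_log_error.
have lim' : (fun n : nat => expR (ln ((u n)%:R : R) / n%:R)) @ \oo --> expR (ln (D%:R :
  R)).
  by apply: continuous_cvg lim; exact: continuous_expR.
apply: cvg_trans lim'; apply: near_eq_cvg; near=> n.
have Nn : (N <= n)%N by near: n; exact: nbhs_infty_ge.
have [_ _ u0 _ _] := pos n Nn.
(* The real power is the exponential of a logarithm only for a nonzero base; the lower bound makes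
   [u n] positive. *)
by rewrite /powR pnatr_eq0 gtn_eqF //= mulrC.
Unshelve. all: by end_near.
Qed.

End Limit.

Theorem theorem1 (F : fieldType) (R : realType) (t : nat) (kd : inv_kind) :
  [pchar F] =i pred0 -> (2 <= t)%N -> (kd = Symp -> ~~ odd t) ->
  (fun n : nat => ((cgr F t kd n)%:R : R) `^ (n%:R)^-1) @ \oo -->
    ((if odd t then (2 * t).-1 else 2 * t)%N%:R : R).
Proof.
move=> ch; case: t => [|[|t0]] // _ hs.
have h2 : 2%:R != 0 :> F by rewrite (pcharf0P F).1.
set t := t0.+2; pose D := (t + t./2.*2)%N.
have -> : (if odd t then (2 * t).-1 else 2 * t)%N = D by rewrite /D; case: ifP; lia.
apply: (@nth_root_limit R _ D (D ^ (t + D.*2)) D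
  (#|generator t|.+1 ^ t.*2 * t.*2 ^ 2) t.*2 (t + D.*2)%N) => // n hn.
  exact: cgr_lower.
rewrite (mulnAC (_ ^ _)%N) -expnMn; apply: cgr_upper => //.
by apply: leq_trans hn.
Qed.
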